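(* Let $n\ge 3$ with $n+1=2N$, let $A$ be the simple $n$-Lie algebra over $\mathbb{C}$ (of dimension $n+1$), and let $\pi_1,\dots,\pi_N$ be the fundamental weights of $so(2N)$. For a weight $\lambda$, let $Z(\lambda)$ be the unique irreducible quotient of the Verma module of $so(2N)$ with highest weight $\lambda$. Then $Z(\lambda)$ is an irreducible representation of $A$ if and only if, for some $t\in\{1,\dots,N\}$ and some $x\in\mathbb{C}$, $$\lambda=\begin{cases} x\pi_1 & t=1,\\ (-1-x)\pi_{t-1}+x\pi_t & 1<t<N-1,\\ (-1-x)\pi_{N-2}+x\pi_{N-1}+x\pi_N & t=N-1,\\ (-1-x)\pi_{N-1}+(-1+x)\pi_N & t=N.\end{cases}$$
   Context: Everything is over $\mathbb{C}$. An $n$-Lie algebra ($n\ge3$) is a vector space $V$ with an $n$-linear antisymmetric bracket satisfying $[[x_1,\ldots,x_n],x_{n+1},\ldots,x_{2n-1}]=\sum_{i=1}^n[x_1,\ldots,[x_i,x_{n+1},\ldots,x_{2n-1}],\ldots,x_n]$. The simple $n$-Lie algebra $A$ is $\mathbb{C}^{n+1}$ with standard basis $e_1,\dots,e_{n+1}$ and bracket $[e_1,\ldots,\hat{e_i},\ldots,e_{n+1}]=(-1)^{n+i+1}e_i$ (hat means omitted), $1\le i\le n+1$. An $n$-Lie module of $V$ is a vector space $M$ together with an $n$-Lie algebra structure on $V\oplus M$ such that $V$ is a subalgebra and $M$ is an abelian ideal (the bracket takes values in $M$ if one entry is in $M$, and is $0$ if at least two entries are in $M$). For $1\le i,j\le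 n+1$ put $e^{ij}=E_{ij}-E_{ji}\in so(n+1)$ (complex skew-symmetric $(n+1)\times(n+1)$ matrices, $E_{ij}$ the matrix units). The space $\wedge^{n-1}A$ is identified, as a Lie algebra, with $so(n+1)$ by sending $e_1\wedge\ldots\wedge\hat{e_i}\wedge\ldots\wedge\hat{e_j}\wedge\ldots\wedge e_{n+1}$ to $e^{ij}$ for $i<j$. An $so(n+1)$-module $M$ is said to be a representation (module) of $A$ if $[x_1,\dots,x_{n-1},m]:=(x_1\wedge\dots\wedge x_{n-1})\cdot m$ makes $M$ an $n$-Lie module of $A$; equivalently, the two-sided ideal $Q(A)$ of the universal enveloping algebra $U(so(n+1))$ generated by the elements $x_{i,k,l,m}=e^{ik}e^{lm}-e^{il}e^{km}+e^{im}e^{kl}$, $1\le i<k<l<m\le n+1$, acts by zero on $M$. It is irreducible as an $A$-module iff it is irreducible as an $so(n+1)$-module. Cartan subalgebra of $so(2N)$: $H=\bigoplus_{j=1}^N\mathbb{C}\epsilon_j$ with $\epsilon_j=\sqrt{-1}\,e^{2j-1,2j}$; weights are elements of $H^*$, and $H$ is identified with $H^*$ by the form $(M_1|M_2)=\frac12\operatorname{trace}(M_1M_2)$, for which $(\epsilon_i|\epsilon_j)=\delta_{ij}$. The simple roots are, in this order, $\epsilon_1-\epsilon_2,\dots,\epsilon_{N-1}-\epsilon_N,\epsilon_{N-1}+\epsilon_N$, and $\pi_1,\dots,\pi_N$ are the corresponding fundamental weights (the basis dual to the simple coroots).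
   Formalization: For N=2 (n=3) the lines t=1 and t=N-1 both apply to t=1 and π_0 is undefined; the line xπ_1 is false there (λ=π_1 fails for so(4)), so the line t=N-1 is used with π_0=0, giving xπ_1+xπ_2; for N≥3 nothing is changed. *)

(* Defs.v *)
From HB Require Import structures.
From mathcomp Require Import all_boot all_order all_fingroup all_algebra.
From mathcomp Require Import generic_quotient ring_quotient.
From mathcomp Require Import boolp reals complex monalg.

Set Implicit Arguments.
Unset Strict Implicit.
Unset Printing Implicit Defensive.

Import GRing.Theory Num.Theory.
Local Open Scope ring_scope.
Local Open Scope quotient_scope.

(* [insert i u y] is the n-tuple with u in slot i whose other slots are filled,
   in order, by the (n-1)-tuple y. *)
Definition insert (n : nat) (T : Type) (i : 'I_n) (u : T)
    (y : {ffun 'I_n.-1 -> T}) : {ffun 'I_n -> T} :=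
  [ffun k => if unlift i k is Some k' then y k' else u].

Definition replace (n : nat) (T : Type) (i : 'I_n) (u : T)
    (x : {ffun 'I_n -> T}) : {ffun 'I_n -> T} :=
  [ffun k => if k == i then u else x k].

Section NLie.
Variables (K : fieldType) (n : nat).

Definition multilinear (V W : lmodType K) (br : {ffun 'I_n -> V} -> W) : Prop :=
  forall (i : 'I_n) (a : K) (u v : V) (x : {ffun 'I_n -> V}),
    br (replace i (a *: u + v) x) =
    a *: br (replace i u x) + br (replace i v x).

Definition antisymmetric_bracket (V W : lmodType K)
    (br : {ffun 'I_n -> V} -> W) : Prop :=
  forall (s : 'S_n) (x : {ffun 'I_n -> V}),
    br [ffun k => x (s k)] = (-1) ^+ s *: br x.

(* Here y is the tuple (x_{n+1}, ..., x_{2n-1}), and i0 is the first slot. *)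
Definition nLie_identity (V : lmodType K) (br : {ffun 'I_n -> V} -> V) : Prop :=
  forall (i0 : 'I_n) (x : {ffun 'I_n -> V}) (y : {ffun 'I_n.-1 -> V}),
    i0 = 0%N :> nat ->
    br (insert i0 (br x) y) =
    \sum_(i < n) br (replace i (br (insert i0 (x i) y)) x).

Definition nLie_algebra (V : lmodType K) (br : {ffun 'I_n -> V} -> V) : Prop :=
  [/\ multilinear br, antisymmetric_bracket br & nLie_identity br].

(* A bracket on V (+) M, represented by V * M, making M an n-Lie module of the
   n-Lie algebra (V, brV). *)
Definition nLie_module (V M : lmodType K) (brV : {ffun 'I_n -> V} -> V)
    (br : {ffun 'I_n -> V * M} -> V * M) : Prop :=
  [/\ nLie_algebra br,
      forall x : {ffun 'I_n -> V}, br [ffun k => (x k, 0)] = (brV x, 0),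
      forall (z : {ffun 'I_n -> V * M}) (i : 'I_n),
        (z i).1 = 0 -> (br z).1 = 0
    & forall (z : {ffun 'I_n -> V * M}) (i j : 'I_n),
        i != j -> (z i).1 = 0 -> (z j).1 = 0 -> br z = 0].

Definition subspace (M : lmodType K) (W : M -> Prop) : Prop :=
  W 0 /\ forall (a : K) (u v : M), W u -> W v -> W (a *: u + v).

Definition nLie_submodule (V M : lmodType K)
    (br : {ffun 'I_n -> V * M} -> V * M) (W : M -> Prop) : Prop :=
  subspace W /\
  forall (i : 'I_n) (x : {ffun 'I_n.-1 -> V}) (m : M),
    W m -> W (br (insert i (0, m) [ffun k => (x k, 0)])).2.

Definition nLie_irreducible (V M : lmodType K)
    (br : {ffun 'I_n -> V * M} -> V * M) : Prop :=
  (exists m : M, m <> 0) /\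
  forall W : M -> Prop, nLie_submodule br W ->
    (forall m, W m -> m = 0) \/ (forall m, W m).

End NLie.

Section LieModules.
Variables (K : fieldType) (L : lmodType K) (br : L -> L -> L) (M : lmodType K).

Definition lie_module (rho : L -> M -> M) : Prop :=
  [/\ forall (a : K) (x y : L) (m : M),
        rho (a *: x + y) m = a *: rho x m + rho y m,
      forall (a : K) (x : L) (u v : M),
        rho x (a *: u + v) = a *: rho x u + rho x v
    & forall (x y : L) (m : M),
        rho (br x y) m = rho x (rho y m) - rho y (rho x m)].

Definition lie_irreducible (rho : L -> M -> M) : Prop :=
  (exists m : M, m <> 0) /\
  forall W : M -> Prop,
    subspace W -> (forall (x : L) (m : M), W m -> W (rho x m)) ->
    (forall m, W m -> m = 0) \/ (forall m, W m).

End LieModules.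

Inductive left_ideal (A : pzRingType) (G : A -> Prop) : A -> Prop :=
| LeftGen x of G x : left_ideal G x
| Left0 : left_ideal G 0
| LeftD x y of left_ideal G x & left_ideal G y : left_ideal G (x + y)
| LeftM a x of left_ideal G x : left_ideal G (a * x).

Inductive ideal (A : pzRingType) (G : A -> Prop) : A -> Prop :=
| IdealGen x of G x : ideal G x
| Ideal0 : ideal G 0
| IdealD x y of ideal G x & ideal G y : ideal G (x + y)
| IdealMl a x of ideal G x : ideal G (a * x)
| IdealMr a x of ideal G x : ideal G (x * a).

Section LinearQuotient.
Variables (K : pzRingType) (V : lmodType K) (I : {pred V}).

Definition submod_pred of submod_closed I : {pred V} := I.

Variable I_submod : submod_closed I.

HB.instance Definition _ :=
  GRing.isZmodClosed.Build V (submod_pred I_submod) (GRing.submod_closedB I_submod).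

Definition lquot : Type := Quotient.quot (submod_pred I_submod).
HB.instance Definition _ := GRing.Zmodule.on lquot.
HB.instance Definition _ :=
  EqQuotient.copy lquot (Quotient.quot (submod_pred I_submod)).

Definition lquot_pi (x : V) : lquot := \pi_lquot x.

Lemma lquot_piP x y : lquot_pi x = lquot_pi y <-> x - y \in I.
Proof.
by split=> [/eqP|xyI]; last apply/eqP;
  rewrite /lquot_pi -(Quotient.idealrBE (submod_pred I_submod)).
Qed.

Lemma lquot_piK (u : lquot) : lquot_pi (repr u) = u.
Proof. exact: reprK. Qed.

Lemma lquot_piD x y : lquot_pi (x + y) = lquot_pi x + lquot_pi y.
Proof. exact: raddfD. Qed.

Definition lquot_scale (a : K) (u : lquot) : lquot := lquot_pi (a *: repr u).

Lemma lquot_piZ a x : lquot_pi (a *: x) = lquot_scale a (lquot_pi x).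
Proof.
apply/lquot_piP; rewrite -scalerBr.
rewrite -[_ *: _]addr0.
apply: I_submod.2; last exact: I_submod.1.
by apply/lquot_piP; rewrite lquot_piK.
Qed.

Fact lquot_scaleA a b u :
  lquot_scale a (lquot_scale b u) = lquot_scale (a * b) u.
Proof. by rewrite -(lquot_piK u) -!lquot_piZ scalerA. Qed.
Fact lquot_scale1 : left_id 1 lquot_scale.
Proof. by move=> u; rewrite -(lquot_piK u) -!lquot_piZ scale1r. Qed.
Fact lquot_scaleDr : right_distributive lquot_scale +%R.
Proof.
move=> a u v; rewrite -(lquot_piK u) -(lquot_piK v).
by rewrite -lquot_piD -!lquot_piZ scalerDr lquot_piD.
Qed.
Fact lquot_scaleDl u : {morph lquot_scale^~ u : a b / a + b}.
Proof.
by move=> a b; rewrite -(lquot_piK u) -!lquot_piZ scalerDl lquot_piD.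
Qed.

HB.instance Definition _ := GRing.Zmodule_isLmodule.Build K lquot
  lquot_scaleA lquot_scale1 lquot_scaleDr lquot_scaleDl.

Fact lquot_pi_linear : linear lquot_pi.
Proof. by move=> a x y; rewrite lquot_piD lquot_piZ. Qed.
HB.instance Definition _ :=
  GRing.isLinear.Build K V lquot *:%R lquot_pi lquot_pi_linear.

End LinearQuotient.

Section IdealQuotients.
Variables (K : pzRingType) (A : algType K) (G : A -> Prop).

Definition left_ideal_pred : {pred A} := fun x => `[< left_ideal G x >].

Fact left_ideal_submod : submod_closed left_ideal_pred.
Proof.
split=> [|a x y /asboolP Gx /asboolP Gy]; apply/asboolP; first exact: Left0.
by apply: LeftD => //; rewrite -mulr_algl; apply: LeftM.
Qed.

Definition ideal_pred : {pred A} := fun x => `[< ideal G x >].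

Fact ideal_submod : submod_closed ideal_pred.
Proof.
split=> [|a x y /asboolP Gx /asboolP Gy]; apply/asboolP; first exact: Ideal0.
by apply: IdealD => //; rewrite -mulr_algl; apply: IdealMl.
Qed.

Definition left_quot : Type := lquot left_ideal_submod.
HB.instance Definition _ := GRing.Lmodule.on left_quot.

Definition left_quot_pi (a : A) : left_quot := lquot_pi left_ideal_submod a.
HB.instance Definition _ := GRing.isLinear.Build K A left_quot *:%R
  left_quot_pi (lquot_pi_linear left_ideal_submod).

Definition left_quot_act (a : A) (u : left_quot) : left_quot :=
  left_quot_pi (a * repr (u : lquot left_ideal_submod)).

Lemma left_quot_actE a b :
  left_quot_act a (left_quot_pi b) = left_quot_pi (a * b).
Proof.
apply/(lquot_piP left_ideal_submod); rewrite -mulrBr.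
by apply/asboolP/LeftM/asboolP/(lquot_piP left_ideal_submod); exact: lquot_piK.
Qed.

Definition alg_quot : Type := lquot ideal_submod.
HB.instance Definition _ := GRing.Lmodule.on alg_quot.

Definition alg_quot_pi (a : A) : alg_quot := lquot_pi ideal_submod a.

Definition alg_quot_mul (u v : alg_quot) : alg_quot :=
  alg_quot_pi (repr (u : lquot ideal_submod) * repr (v : lquot ideal_submod)).

Lemma alg_quot_piK (u : alg_quot) :
  alg_quot_pi (repr (u : lquot ideal_submod)) = u.
Proof. exact: lquot_piK. Qed.

Lemma alg_quot_piM a b :
  alg_quot_pi (a * b) = alg_quot_mul (alg_quot_pi a) (alg_quot_pi b).
Proof.
set a' := repr (alg_quot_pi a : lquot ideal_submod).
set b' := repr (alg_quot_pi b : lquot ideal_submod).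
have aE : ideal G (a - a').
  apply/asboolP/(lquot_piP ideal_submod).
  by rewrite -[RHS]/(alg_quot_pi a') alg_quot_piK.
have bE : ideal G (b - b').
  apply/asboolP/(lquot_piP ideal_submod).
  by rewrite -[RHS]/(alg_quot_pi b') alg_quot_piK.
apply/(lquot_piP ideal_submod)/asboolP.
have -> : a * b - a' * b' = (a - a') * b + a' * (b - b').
  by rewrite mulrBl mulrBr addrA subrK.
by apply: IdealD; [apply: IdealMr | apply: IdealMl].
Qed.

Lemma alg_quot_piD a b : alg_quot_pi (a + b) = alg_quot_pi a + alg_quot_pi b.
Proof. exact: lquot_piD. Qed.

Lemma alg_quot_piZ k a : alg_quot_pi (k *: a) = k *: alg_quot_pi a.
Proof. exact: lquot_piZ. Qed.

Fact alg_quot_mulA : associative alg_quot_mul.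
Proof.
move=> u v w; rewrite -(alg_quot_piK u) -(alg_quot_piK v) -(alg_quot_piK w).
by rewrite -!alg_quot_piM mulrA.
Qed.
Fact alg_quot_mul1 : left_id (alg_quot_pi 1) alg_quot_mul.
Proof. by move=> u; rewrite -(alg_quot_piK u) -!alg_quot_piM mul1r. Qed.
Fact alg_quot_mulr1 : right_id (alg_quot_pi 1) alg_quot_mul.
Proof. by move=> u; rewrite -(alg_quot_piK u) -!alg_quot_piM mulr1. Qed.
Fact alg_quot_mulDl : left_distributive alg_quot_mul +%R.
Proof.
move=> u v w; rewrite -(alg_quot_piK u) -(alg_quot_piK v) -(alg_quot_piK w).
by rewrite -alg_quot_piD -!alg_quot_piM mulrDl alg_quot_piD.
Qed.
Fact alg_quot_mulDr : right_distributive alg_quot_mul +%R.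
Proof.
move=> u v w; rewrite -(alg_quot_piK u) -(alg_quot_piK v) -(alg_quot_piK w).
by rewrite -alg_quot_piD -!alg_quot_piM mulrDr alg_quot_piD.
Qed.

HB.instance Definition _ := GRing.Zmodule_isPzRing.Build alg_quot
  alg_quot_mulA alg_quot_mul1 alg_quot_mulr1 alg_quot_mulDl alg_quot_mulDr.

Fact alg_quot_scaleAl (k : K) (u v : alg_quot) : k *: (u * v) = (k *: u) * v.
Proof.
rewrite -(alg_quot_piK u) -(alg_quot_piK v) -alg_quot_piZ.
by rewrite -[_ * _]alg_quot_piM -[RHS]alg_quot_piM -alg_quot_piZ scalerAl.
Qed.

Fact alg_quot_scaleAr (k : K) (u v : alg_quot) : k *: (u * v) = u * (k *: v).
Proof.
rewrite -(alg_quot_piK u) -(alg_quot_piK v) -alg_quot_piZ.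
by rewrite -[_ * _]alg_quot_piM -[RHS]alg_quot_piM -alg_quot_piZ scalerAr.
Qed.

End IdealQuotients.

(* Coefficients times words in the letters of L, i.e. the free unital
   associative algebra on the underlying set of L. *)
Definition free_alg (K : fieldType) (L : choiceType) : Type :=
  {malg K[{fmonom L}]}.
HB.instance Definition _ (K : fieldType) (L : choiceType) :=
  GRing.Lalgebra.on (free_alg K L).

Fact free_alg_scaleAr (K : fieldType) (L : choiceType) (k : K)
  (u v : free_alg K L) : k *: (u * v) = u * (k *: v).
Proof.
have mulC : k%:MP * u = u * k%:MP.
  rewrite [u]monalgE mulr_sumr mulr_suml; apply: eq_bigr => m _.
  by rewrite [LHS]fgmulUU [RHS]fgmulUU mul1m mulm1 mulrC.
by rewrite -!mul_malgC !mulrA mulC.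
Qed.
HB.instance Definition _ (K : fieldType) (L : choiceType) :=
  GRing.LSemiAlgebra_isSemiAlgebra.Build K (free_alg K L)
    (@free_alg_scaleAr K L).

Section UEA.
Variables (K : fieldType) (L : lmodType K) (br : L -> L -> L).

Definition letter (x : L) : free_alg K L := << fmu x >>.

Inductive UEA_relation : free_alg K L -> Prop :=
| UEA_linear a x y :
    UEA_relation (letter (a *: x + y) - (a *: letter x + letter y))
| UEA_bracket x y :
    UEA_relation (letter x * letter y - letter y * letter x - letter (br x y)).

Fact UEA_relation_augment (t : free_alg K L) :
  ideal UEA_relation t -> (t : {malg K[{fmonom L}]})@_mone = 0.
Proof.
have letter0 x : (letter x : {malg K[{fmonom L}]})@_mone = 0.
  by rewrite mcoeffU; case: eqP => // /(congr1 (@fmonom_val L)); rewrite fmuE fm1.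
elim=> {t} [t [a x y|x y]||t u _ t0 _ u0|a t _ t0|a t _ t0].
- by rewrite mcoeffB mcoeffD mcoeffZ !letter0 mulr0 addr0 subr0.
- by rewrite !mcoeffB !rmorphM /= !letter0 mulr0 !subr0.
- by rewrite mcoeff0.
- by rewrite mcoeffD t0 u0 addr0.
- by rewrite rmorphM /= t0 mulr0.
- by rewrite rmorphM /= t0 mul0r.
Qed.

Definition UEA : Type := alg_quot UEA_relation.
HB.instance Definition _ := GRing.PzRing.on UEA.
HB.instance Definition _ := GRing.Lmodule.on UEA.

Fact UEA_nonzero : 1 != 0 :> UEA.
Proof.
apply/eqP => eq10; have : 1 - 0 \in ideal_pred UEA_relation.
  apply/(lquot_piP (ideal_submod UEA_relation)).
  by rewrite [RHS]linear0; exact: eq10.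
move=> /asboolP/UEA_relation_augment/eqP.
by rewrite subr0 mcoeffU1 eqxx oner_eq0.
Qed.
HB.instance Definition _ := GRing.PzSemiRing_isNonZero.Build UEA UEA_nonzero.
HB.instance Definition _ := GRing.Lmodule_isLalgebra.Build K UEA
  (@alg_quot_scaleAl _ _ UEA_relation).
HB.instance Definition _ := GRing.Lalgebra_isAlgebra.Build K UEA
  (@alg_quot_scaleAr _ _ UEA_relation).

Definition UEA_inj (x : L) : UEA := alg_quot_pi UEA_relation (letter x).

End UEA.

Definition skew (K : pzRingType) (d : nat) : {pred 'M[K]_d} :=
  fun x => x^T == - x.

Section So.
Variables (K : numClosedFieldType) (d : nat).

Fact skew_submod : submod_closed (@skew K d).
Proof.
rewrite /skew; split=> [|a x y]; rewrite !unfold_in ?trmx0 ?oppr0 // => /eqP sx /eqP sy.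
by rewrite linearD linearZ /= sx sy scalerN -opprD.
Qed.
HB.instance Definition _ :=
  GRing.isSubmodClosed.Build K 'M[K]_d (@skew K d) skew_submod.

Record so : predArgType := So { so_val :> 'M[K]_d; so_valP : so_val \in @skew K d }.
HB.instance Definition _ := [isSub for so_val].
HB.instance Definition _ := [Choice of so by <:].
HB.instance Definition _ := [SubChoice_isSubLmodule of so by <:].

Fact so_bracketP (x y : so) :
  so_val x *m so_val y - so_val y *m so_val x \in @skew K d.
Proof.
case: x y => [x /eqP sx] [y /eqP sy] /=; rewrite unfold_in linearB /=.
by rewrite !trmx_mul sx sy !mulNmx !mulmxN !opprK opprB.
Qed.
Definition so_bracket (x y : so) : so := So (so_bracketP x y).

Fact so_unitP (i j : 'I_d) : delta_mx i j - delta_mx j i \in @skew K d.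
Proof. by rewrite unfold_in linearB /= !trmx_delta opprB. Qed.

(* The elements e^{ij}, with indices starting from 0. *)
Definition so_unit (i j : 'I_d) : so := So (so_unitP i j).

Definition so_form (x y : so) : K := 2^-1 * \tr (so_val x *m so_val y).

End So.

Section SimpleNLie.
Variables (K : numClosedFieldType) (n : nat).

(* The multilinear alternating extension of
   [e_1, .., ^e_i, .., e_{n+1}] = (-1)^{n+i+1} e_i (1 <= i <= n+1); the sign
   below accounts for indices starting from 0. *)
Definition simple_bracket (x : {ffun 'I_n -> 'rV[K]_n.+1}) : 'rV[K]_n.+1 :=
  \row_(i < n.+1)
    ((-1) ^+ (n + i) * \det (col' i (\matrix_(k < n) x k))).

(* x_1 /\ .. /\ x_{n-1} under the identification of /\^{n-1} A with so(n+1):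
   the coordinates of a wedge product are the maximal minors, and
   e_1 /\ .. ^e_i .. ^e_j .. /\ e_{n+1} is sent to e^{ij}, for i < j. *)
Definition wedge (x : {ffun 'I_n.-1 -> 'rV[K]_n.+1}) : so K n.+1 :=
  \sum_(j < n.+1) \sum_(i < n | (i < j)%N)
    \det (col' i (col' j (\matrix_(k < n.-1) x k)))
      *: so_unit K (widen_ord (leqnSn n) i) j.

Lemma simple_bracket_basis (i : 'I_n.+1) :
  simple_bracket [ffun k => delta_mx 0 (lift i k)] =
  (-1) ^+ (n + i) *: delta_mx 0 i.
Proof.
apply/rowP=> j; rewrite mxE [RHS]mxE mxE eqxx /=.
have [<-|neq_ij] := eqVneq i j.
  rewrite [X in \det X](_ : _ = 1%:M) ?det1 //.
  by apply/matrixP=> k l; rewrite !mxE ffunE mxE eqxx (inj_eq lift_inj) eq_sym.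
rewrite mulr0.
have [l jl|ij] := unliftP j i; last by rewrite ij eqxx in neq_ij.
rewrite (expand_det_col _ l) big1 ?mulr0 // => k _.
by rewrite !mxE ffunE mxE -jl (negbTE (neq_lift _ _)) andbF mul0r.
Qed.

Lemma wedge_basis (i : 'I_n) (j : 'I_n.+1) : (i < j)%N ->
  wedge [ffun k => delta_mx 0 (lift j (lift i k))] =
  so_unit K (widen_ord (leqnSn n) i) j.
Proof.
have lift_widen (a : 'I_n) (b : 'I_n.+1) : (a < b)%N ->
    lift b a = widen_ord (leqnSn n) a.
  by move=> ab; apply/val_inj; rewrite /= /bump leqNgt ab.
move=> ij; rewrite /wedge (bigD1 j) //= (bigD1 i) //=.
rewrite [X in \det X *: _](_ : _ = 1%:M); last first.
  apply/matrixP=> k l; rewrite !mxE ffunE mxE eqxx /=.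
  by rewrite !(inj_eq lift_inj) eq_sym.
rewrite det1 scale1r.
have minor0 (a : 'I_n) (b : 'I_n.+1) k : (a < b)%N ->
    (lift j (lift i k) == b) || (lift j (lift i k) == lift b a) ->
    \det (col' a (col' b (\matrix_(k < n.-1)
      [ffun k => delta_mx (0 : 'I_1) (lift j (lift i k))] k))) = 0 :> K.
  move=> ab kab; rewrite (expand_det_row _ k) big1 // => c _.
  rewrite !mxE ffunE mxE eqxx /= eq_sym.
  case/orP: kab => /eqP->; first by rewrite (negbTE (neq_lift _ _)) mul0r.
  by rewrite (inj_eq lift_inj) (negbTE (neq_lift _ _)) mul0r.
rewrite !big1 ?addr0 // => [b bj|a /andP[aj ai]].
  apply: big1 => a ab; case: (unliftP j b) => [b' bE|bE]; last first.
    by rewrite bE eqxx in bj.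
  have [b'i|] := eqVneq i b'; last first.
    move=> /unlift_some[k kE _].
    by rewrite (minor0 a b k) ?scale0r // bE kE eqxx.
  have bi : b = i :> nat by rewrite bE -b'i lift_widen.
  have /unlift_some[k kE _] : i != a by rewrite -val_eqE /= -bi gtn_eqF.
  rewrite (minor0 a b k) ?scale0r // -kE !lift_widen ?eqxx ?orbT //.
  by rewrite (ltn_trans ab) // bi.
rewrite eq_sym in ai.
have [k kE _] := unlift_some ai.
by rewrite (minor0 a j k) ?scale0r // -kE eqxx orbT.
Qed.

(* A bracket on A (+) M making M an n-Lie module of A, whose restriction to
   A x .. x A x M is given by the action rho of so(n+1). *)
Definition induced_bracket (M : lmodType K) (rho : so K n.+1 -> M -> M)
    (br : {ffun 'I_n -> 'rV[K]_n.+1 * M} -> 'rV[K]_n.+1 * M) : Prop :=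
  nLie_module simple_bracket br /\
  forall (last : 'I_n) (x : {ffun 'I_n.-1 -> 'rV[K]_n.+1}) (m : M),
    last = n.-1 :> nat ->
    br (insert last (0, m) [ffun k => (x k, 0)]) = (0, rho (wedge x) m).

Definition irreducible_representation (M : lmodType K)
    (rho : so K n.+1 -> M -> M) : Prop :=
  lie_module (@so_bracket K n.+1) rho /\
  exists br, induced_bracket rho br /\ nLie_irreducible br.

End SimpleNLie.

Section HighestWeight.
Variables (K : numClosedFieldType) (n N : nat).

(* In this section n.+1 = N.*2 is intended. The j-th basis vector of H, with
   j starting from 0; the indices 2j and 2j+1 are elements of 'I_n.+1. *)
Definition eps (j : 'I_N) : so K n.+1 :=
  'i *: so_unit K (inord j.*2) (inord j.*2.+1).

(* Elements of H, and of H^* identified with H by so_form, are given by their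
   coordinates in the basis eps. *)
Definition cartan (h : 'rV[K]_N) : so K n.+1 := \sum_(j < N) h 0 j *: eps j.

Definition weight_form (lam h : 'rV[K]_N) : K :=
  so_form (cartan lam) (cartan h).

Definition simple_root (i : 'I_N) : 'rV[K]_N :=
  if (i.+1 < N)%N then \row_j ((j == i)%:R - (j == i.+1 :> nat)%:R)
  else \row_j ((j == i.-1 :> nat)%:R + (j == i)%:R).

Definition simple_coroot (i : 'I_N) : 'rV[K]_N :=
  (2 / weight_form (simple_root i) (simple_root i)) *: simple_root i.

(* Fundamental weights are numbered from 1, while simple roots are numbered from
   0; the convention pi_0 = 0 is used in weight_family when N = 2. *)
Definition fundamental_weights (pi : nat -> 'rV[K]_N) : Prop :=
  pi 0%N = 0 /\
  forall i j : 'I_N, weight_form (pi i.+1) (simple_coroot j) = (i == j)%:R.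

Definition root_vector (alpha : 'rV[K]_N) (x : so K n.+1) : Prop :=
  forall h : 'rV[K]_N,
    so_bracket (cartan h) x = weight_form alpha h *: x.

Definition positive_root (alpha : 'rV[K]_N) : Prop :=
  [/\ alpha <> 0,
      exists c : 'I_N -> nat, alpha = \sum_(i < N) (c i)%:R *: simple_root i
    & exists2 x : so K n.+1, x <> 0 & root_vector alpha x].

Local Notation U_so := (UEA (@so_bracket K n.+1)).

Definition U_so_inj (x : so K n.+1) : U_so := UEA_inj (@so_bracket K n.+1) x.

(* U(g) (x)_{U(b)} K_lam is the quotient of U(g) by the left ideal generated by
   these elements. *)
Inductive verma_relation (lam : 'rV[K]_N) : U_so -> Prop :=
| verma_positive alpha x of positive_root alpha & root_vector alpha x :
    verma_relation lam (U_so_inj x)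
| verma_cartan h :
    verma_relation lam (U_so_inj (cartan h) - (weight_form lam h)%:A).

Definition verma (lam : 'rV[K]_N) : Type := left_quot (verma_relation lam).
HB.instance Definition _ (lam : 'rV[K]_N) :=
  GRing.Lmodule.copy (verma lam) (left_quot (verma_relation lam)).

Definition verma_act (lam : 'rV[K]_N) (x : so K n.+1) (v : verma lam) :
  verma lam := left_quot_act (U_so_inj x) v.

Definition irreducible_quotient_of_verma (lam : 'rV[K]_N) (Z : lmodType K)
    (rho : so K n.+1 -> Z -> Z) : Prop :=
  [/\ lie_module (@so_bracket K n.+1) rho,
      lie_irreducible rho
    & exists f : {linear verma lam -> Z},
        (forall z : Z, exists v, f v = z) /\
        (forall x v, f (verma_act x v) = rho x (f v))].

(* The t = N-1 case precedes the t = 1 case: for N = 2, where both apply, the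
   weight is x pi_1 + x pi_2 = x eps_1 (recall pi_0 = 0). *)
Definition weight_family (pi : nat -> 'rV[K]_N) (t : nat) (x : K) : 'rV[K]_N :=
  if t == N then (-1 - x) *: pi N.-1 + (-1 + x) *: pi N
  else if t == N.-1 then
    (-1 - x) *: pi N.-2 + x *: pi N.-1 + x *: pi N
  else if t == 1%N then x *: pi 1%N
  else (-1 - x) *: pi t.-1 + x *: pi t.

End HighestWeight.

(* Main.v *)
Require Import Defs.
From HB Require Import structures.
From mathcomp Require Import all_boot all_order all_fingroup all_algebra.
From mathcomp Require Import reals complex.
From mathcomp Require Import boolp monalg ring zify.
Set Implicit Arguments.
Unset Strict Implicit.
Unset Printing Implicit Defensive.
Import GRing.Theory Num.Theory.
Local Open Scope ring_scope.

(* An so(n+1)-module is an A-module iff all x_{a,b,c,d} vanish on it.  Their span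
   is ad-invariant, so on an irreducible highest weight module this can be tested
   on the highest weight vector v.  In an isotropic basis u_j, u_j' with
   (u_j, u_j') = 2, the elements x(u_i, u_i', u_j, u_j'), i < j, act on v by
   4 lam_j (lam_i + 1).  If all these scalars vanish, then by descending induction
   on the height every x(..) v is a singular vector; a nonzero singular vector of
   an irreducible module has the weight of v, so only the weight zero elements
   matter, and these are the ones above.  Finally lam_j (lam_i + 1) = 0 for all
   i < j means lam = (-1, .., -1, x, 0, .., 0). *)

(** * Tuples and determinants *)

(** The bracket of [A] is a cross product, hence equivariant under skew matrices. This settles the
    n-Lie identity on the sum of [A] and [M] except when a module entry sits among the last n-1
    arguments. There Cramer's rule collapses the sum over slots to a combination of the x_{a,b,c,d},
    and suitable basis vectors as arguments isolate each of them, so their vanishing is necessary as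
    well as sufficient.

    The x_{a,b,c,d} are quadratic in noncommuting operators and alternate only on distinct
    orthonormal vectors. Passing to an isotropic basis requires lower order terms; these and the
    commutators with raising operators produce the 1 in lam_i + 1.

    [M] may be infinite-dimensional with arbitrary complex weights, so no finite set of weights or
    order on them is at hand. Weights of singular vectors are compared through the operators eps_1 +
    .. + eps_k: each lowering operator decreases their eigenvalues by a natural number. Two nonzero
    singular weight vectors generate the same irreducible module, each lies below the other, and all
    these eigenvalues agree. *)

Section Tuples.
Variables (n : nat) (T : Type).
Implicit Types (x : {ffun 'I_n -> T}) (y : {ffun 'I_n.-1 -> T}).

Lemma replace_self i u x : replace i u x i = u.
Proof. by rewrite ffunE eqxx. Qed.

Lemma replace_neq i j u x : j != i -> replace i u x j = x j.
Proof. by rewrite ffunE => /negbTE->. Qed.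

Lemma replaceK i u w x : replace i u (replace i w x) = replace i u x.
Proof. by apply/ffunP=> k; rewrite !ffunE; case: eqP. Qed.

Lemma replace_id i x : replace i (x i) x = x.
Proof. by apply/ffunP=> k; rewrite !ffunE; case: eqP => // ->. Qed.

Lemma replaceC i j u w x : i != j ->
  replace i u (replace j w x) = replace j w (replace i u x).
Proof.
move=> /eqP ij; apply/ffunP=> k; rewrite !ffunE.
by case: eqP => [->|//]; case: eqP.
Qed.

Lemma insert_self i u y : insert i u y i = u.
Proof. by rewrite ffunE unlift_none. Qed.

Lemma insert_lift i u y k : insert i u y (lift i k) = y k.
Proof. by rewrite ffunE liftK. Qed.

Lemma replace_insert i u w y : replace i u (insert i w y) = insert i u y.
Proof.
apply/ffunP=> k; rewrite !ffunE; case: (unliftP i k) => [k' ->|->].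
  by rewrite eq_sym (negbTE (neq_lift _ _)).
by rewrite eqxx.
Qed.

End Tuples.

Section Determinants.
Variable K : fieldType.

Definition detr d (z : {ffun 'I_d -> 'rV[K]_d}) : K := \det (\matrix_k z k).

Lemma detr_alt d (z : {ffun 'I_d -> 'rV[K]_d}) i j :
  i != j -> z i = z j -> detr z = 0.
Proof.
by move=> ij zij; apply: (determinant_alternate ij) => k; rewrite !mxE zij.
Qed.

Lemma detr_replace_cofactor d i (u : 'rV[K]_d) (z : {ffun 'I_d -> 'rV[K]_d}) :
  detr (replace i u z) = \sum_b u 0 b * cofactor (\matrix_k z k) i b.
Proof.
rewrite /detr (expand_det_row _ i); apply: eq_bigr => b _.
rewrite mxE replace_self; congr (_ * (_ * \det _)).
by apply/matrixP=> k l; rewrite !mxE replace_neq // eq_sym neq_lift.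
Qed.

Lemma detr_replaceE d i (u : 'rV[K]_d) (z : {ffun 'I_d -> 'rV[K]_d}) :
  detr (replace i u z) = \sum_b u 0 b * detr (replace i (delta_mx 0 b) z).
Proof.
rewrite detr_replace_cofactor; apply: eq_bigr => b _; congr (_ * _).
rewrite detr_replace_cofactor (bigD1 b) //= mxE !eqxx mul1r big1 ?addr0 //.
by move=> c /negbTE cb; rewrite mxE cb andbF mul0r.
Qed.

Lemma detr_perm d (s : 'S_d) (z : {ffun 'I_d -> 'rV[K]_d}) :
  detr [ffun k => z (s k)] = (-1) ^+ s * detr z.
Proof.
rewrite -det_perm -det_mulmx -row_permE; congr (\det _).
by apply/matrixP=> k l; rewrite !mxE ffunE.
Qed.

Lemma detr_swap d i j u w (z : {ffun 'I_d -> 'rV[K]_d}) : i != j ->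
  detr (replace i u (replace j w z)) = - detr (replace i w (replace j u z)).
Proof.
move=> ij; have := detr_perm (tperm i j) (replace i w (replace j u z)).
rewrite odd_tperm ij expr1 mulN1r => <-; congr detr; apply/ffunP=> k.
rewrite !ffunE; case: tpermP => [->|->|/eqP/negbTE-> /eqP/negbTE->//].
  by rewrite eqxx eq_sym (negbTE ij) eqxx.
by rewrite !eqxx eq_sym (negbTE ij).
Qed.

(* This is tr (A S adj A) = tr S det A. *)
Lemma detr_derivation d (S : 'M[K]_d) (z : {ffun 'I_d -> 'rV[K]_d}) :
  \sum_i detr (replace i (z i *m S) z) = \tr S * detr z.
Proof.
set A := \matrix_k z k.
transitivity (\tr (A *m S *m \adj A)).
  rewrite /mxtrace; apply: eq_bigr => i _.
  rewrite detr_replace_cofactor [RHS]mxE.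
  apply: eq_bigr => b _; rewrite [(\adj A) _ _]mxE; congr (_ * _).
  by rewrite !mxE; apply: eq_bigr => k _; rewrite [A _ _]mxE.
by rewrite -mulmxA mxtrace_mulC -mulmxA mul_adj_mx mul_mx_scalar mxtraceZ mulrC.
Qed.

Lemma detr_cramer d (u : 'rV[K]_d) (z : {ffun 'I_d -> 'rV[K]_d}) :
  \sum_i detr (replace i u z) *: z i = detr z *: u.
Proof.
set A := \matrix_k z k.
rewrite -[detr z *: u]mul_mx_scalar -mul_adj_mx mulmxA mulmx_sum_row.
apply: eq_bigr => i _; rewrite rowK detr_replace_cofactor !mxE.
by congr (_ *: _); apply: eq_bigr => b _; rewrite [in RHS]mxE.
Qed.

Variable n : nat.
Implicit Types (x : {ffun 'I_n -> 'rV[K]_n.+1}).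

Definition ext x (w : 'rV[K]_n.+1) : {ffun 'I_n.+1 -> 'rV[K]_n.+1} :=
  insert ord_max w x.

Lemma ext_replace i u x w :
  ext (replace i u x) w = replace (lift ord_max i) u (ext x w).
Proof.
apply/ffunP=> k; rewrite !ffunE; case: unliftP => [k' ->|->].
  by rewrite ffunE (inj_eq lift_inj).
by rewrite (negbTE (neq_lift _ _)).
Qed.

Lemma ext_max x u w : ext x w = replace ord_max w (ext x u).
Proof. by rewrite /ext replace_insert. Qed.

Lemma ext_perm (s : 'S_n) x w :
  ext [ffun k => x (s k)] w = [ffun k => ext x w (lift_perm ord_max ord_max s k)].
Proof.
apply/ffunP=> k; rewrite !ffunE; case: (unliftP ord_max k) => [k' ->|->].
  by rewrite lift_perm_lift liftK !ffunE.
by rewrite lift_perm_id unlift_none.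
Qed.

End Determinants.

(** * The bracket of [A] as a cross product *)

Section SimpleBracket.
Variables (K : numClosedFieldType) (n : nat).
Local Notation V := 'rV[K]_n.+1.
Local Notation e a := (delta_mx 0 a : V).
Implicit Types (x : {ffun 'I_n -> V}) (y : {ffun 'I_n.-1 -> V}).

(** The sign in [simple_bracket] is the cofactor sign of the last row of an (n+1)-square matrix. So
    the bracket is the vector representing w |-> det (x_1, .., x_n, w), a generalized cross
    product. *)
Lemma simple_bracketE x a : simple_bracket x 0 a = detr (ext x (e a)).
Proof.
rewrite mxE /detr (expand_det_row _ ord_max) (bigD1 a) //=.
rewrite big1 => [|b /negbTE ba]; last first.
  by rewrite mxE insert_self mxE ba andbF mul0r.
rewrite mxE insert_self mxE !eqxx addr0 mul1r; congr (_ * \det _).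
by apply/matrixP=> k l; rewrite !mxE insert_lift.
Qed.

Lemma simple_bracket_dot x (w : V) :
  \sum_a simple_bracket x 0 a * w 0 a = detr (ext x w).
Proof.
rewrite (ext_max _ 0) detr_replaceE; apply: eq_bigr => a _.
by rewrite simple_bracketE (ext_max _ 0) mulrC.
Qed.

Lemma simple_bracket_replaceE i (u : V) x :
  simple_bracket (replace i u x) =
  \sum_b u 0 b *: simple_bracket (replace i (e b) x).
Proof.
apply/rowP=> a; rewrite summxE simple_bracketE ext_replace detr_replaceE.
by apply: eq_bigr => b _; rewrite [RHS]mxE simple_bracketE ext_replace.
Qed.

Lemma simple_bracket_multilinear : multilinear (@simple_bracket K n).
Proof.
move=> i a u v x; rewrite ![simple_bracket (replace i _ _)]simple_bracket_replaceE.
rewrite scaler_sumr -big_split; apply: eq_bigr => b _ /=.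
by rewrite !mxE scalerDl scalerA.
Qed.

Lemma simple_bracket_perm (s : 'S_n) x :
  simple_bracket [ffun k => x (s k)] = (-1) ^+ s *: simple_bracket x.
Proof.
apply/rowP=> a; rewrite simple_bracketE ext_perm detr_perm odd_lift_perm /=.
by rewrite addbb [RHS]mxE simple_bracketE.
Qed.

Lemma simple_bracket_swap x i j u w : i != j ->
  simple_bracket (replace i u (replace j w x)) =
  - simple_bracket (replace i w (replace j u x)).
Proof.
move=> ij; apply/rowP=> a; rewrite [RHS]mxE !simple_bracketE !ext_replace detr_swap //.
by rewrite (inj_eq lift_inj).
Qed.

Lemma simple_bracket_skew x i a b :
  simple_bracket (replace i (e b) x) 0 a = - simple_bracket (replace i (e a) x) 0 b.
Proof.
rewrite !simple_bracketE !ext_replace 2!(ext_max x 0 (e _)) detr_swap //.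
by rewrite eq_sym neq_lift.
Qed.

(* Cramer's rule for e_b in terms of x_1, .., x_n, e_a. *)
Lemma simple_bracket_cramer x a b :
  \sum_i simple_bracket (replace i (e b) x) 0 a *: x i =
  simple_bracket x 0 a *: e b - simple_bracket x 0 b *: e a.
Proof.
have := detr_cramer (e b) (ext x (e a)).
rewrite -simple_bracketE (bigD1_ord ord_max) //= insert_self -(ext_max _ (e a)).
rewrite -simple_bracketE => <-; rewrite [RHS]addrC addKr; apply: eq_bigr => i _.
by rewrite -ext_replace -simple_bracketE insert_lift.
Qed.

End SimpleBracket.

(** * The Lie algebra so(d) *)

(* The square-zero extension of K by M turns linear identities in M into
   identities of a commutative ring, where [ring] applies. *)
Section Idealization.
Variables (K : comNzRingType) (M : lmodType K).

Definition idealization : Type := (K * M)%type.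
HB.instance Definition _ := GRing.Zmodule.on idealization.

Definition idealization_mul (x y : idealization) : idealization :=
  (x.1 * y.1, x.1 *: y.2 + y.1 *: x.2).

Fact idealization_mulA : associative idealization_mul.
Proof.
move=> [a u] [b v] [c w]; congr pair => /=; first exact: mulrA.
by rewrite !scalerDr !scalerA addrA (mulrC c a) (mulrC c b).
Qed.
Fact idealization_mulC : commutative idealization_mul.
Proof. by move=> [a u] [b v]; congr pair; [exact: mulrC | exact: addrC]. Qed.
Fact idealization_mul1 : left_id ((1, 0) : idealization) idealization_mul.
Proof. by move=> [a u]; congr pair => /=; rewrite ?mul1r // scaler0 addr0 scale1r. Qed.
Fact idealization_mulDl : left_distributive idealization_mul +%R.
Proof.
move=> [a u] [b v] [c w]; congr pair => /=; first exact: mulrDl.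
by rewrite scalerDl scalerDr addrACA.
Qed.
Fact idealization_nonzero : (1, 0) != 0 :> idealization.
Proof. by apply/eqP => -[/eqP]; rewrite oner_eq0. Qed.

HB.instance Definition _ := GRing.Zmodule_isComNzRing.Build idealization
  idealization_mulA idealization_mulC idealization_mul1 idealization_mulDl
  idealization_nonzero.

Definition scal_in (a : K) : idealization := (a, 0).
Definition vect_in (u : M) : idealization := (0, u).

Fact scal_in_zmod_morphism : zmod_morphism scal_in.
Proof. by move=> a b; congr pair; rewrite /= subr0. Qed.
Fact scal_in_monoid_morphism : monoid_morphism scal_in.
Proof. by split=> // a b; congr pair; rewrite /= !scaler0 addr0. Qed.
HB.instance Definition _ :=
  GRing.isZmodMorphism.Build K idealization scal_in scal_in_zmod_morphism.
HB.instance Definition _ :=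
  GRing.isMonoidMorphism.Build K idealization scal_in scal_in_monoid_morphism.

Lemma vect_in_inj : injective vect_in. Proof. by move=> u v []. Qed.
Lemma vect_inD u v : vect_in (u + v) = vect_in u + vect_in v.
Proof. by congr pair; rewrite /= addr0. Qed.
Lemma vect_inN u : vect_in (- u) = - vect_in u.
Proof. by congr pair; rewrite /= oppr0. Qed.
Lemma vect_in0 : vect_in 0 = 0. Proof. by []. Qed.
Lemma vect_inZ a u : vect_in (a *: u) = scal_in a * vect_in u.
Proof. by congr pair; rewrite /= ?mulr0 // scale0r addr0. Qed.
Lemma vect_inMn u k : vect_in (u *+ k) = vect_in u *+ k.
Proof. by elim: k => // k IH; rewrite !mulrS vect_inD IH. Qed.
Definition vect_inE := (vect_inD, vect_inN, vect_in0, vect_inZ, vect_inMn).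
End Idealization.

Ltac module := apply: vect_in_inj; rewrite ?vect_inE; ring.

Section So.
Variables (K : numClosedFieldType) (d : nat).
Local Notation V := 'rV[K]_d.
Implicit Types (x y : so K d) (a b c : V).

Lemma so_valD x y i j : so_val (x + y) i j = so_val x i j + so_val y i j.
Proof.
have /matrixP-> := raddfD (\val : so K d -> 'M[K]_d) x y; exact: mxE.
Qed.
Lemma so_valZ k x i j : so_val (k *: x) i j = k * so_val x i j.
Proof.
have /matrixP-> := linearZ_LR (\val : so K d -> 'M[K]_d) k x; exact: mxE.
Qed.
Lemma so_valN x i j : so_val (- x) i j = - so_val x i j.
Proof.
have /matrixP-> := raddfN (\val : so K d -> 'M[K]_d) x; exact: mxE.
Qed.
Lemma so_val_sum I (r : seq I) P (F : I -> so K d) i j :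
  so_val (\sum_(k <- r | P k) F k) i j = \sum_(k <- r | P k) so_val (F k) i j.
Proof.
have /matrixP-> := raddf_sum (\val : so K d -> 'M[K]_d) r P F; exact: summxE.
Qed.
Lemma so_val_bracket x y i j : so_val (so_bracket x y) i j =
  (so_val x *m so_val y) i j - (so_val y *m so_val x) i j.
Proof. by rewrite !mxE. Qed.

Lemma so_ext x y : (forall i j, so_val x i j = so_val y i j) -> x = y.
Proof. by move=> xy; apply/val_inj/matrixP. Qed.

Lemma so_skew x i j : so_val x i j = - so_val x j i.
Proof. by have /eqP/matrixP/(_ j i) := so_valP x; rewrite !mxE. Qed.

Fact bivector_subproof a b : a^T *m b - b^T *m a \in @Defs.skew K d.
Proof. by rewrite unfold_in linearB /= !trmx_mul !trmxK opprB. Qed.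
(** The image of a /\ b under the isomorphism of the second exterior power with so(d). Arbitrary
    vectors are allowed so that isotropic ones can replace the standard basis. *)
Definition bivector a b : so K d := So (bivector_subproof a b).

Lemma bivectorE a b i j :
  so_val (bivector a b) i j = a 0 i * b 0 j - b 0 i * a 0 j.
Proof. by rewrite !mxE !big_ord1 !mxE. Qed.

Lemma so_unit_bivector i j :
  so_unit K i j = bivector (delta_mx 0 i) (delta_mx 0 j).
Proof.
apply: so_ext => k l; rewrite [RHS]bivectorE !mxE !eqxx /=.
by rewrite -!natrM !mulnb [in X in _ - X]andbC andbC [(l == j) && _]andbC.
Qed.

Definition dot a b : K := \sum_i a 0 i * b 0 i.

Lemma dotC a b : dot a b = dot b a.
Proof. by apply: eq_bigr => i _; rewrite mulrC. Qed.
Lemma dotDl a b c : dot (a + b) c = dot a c + dot b c.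
Proof. by rewrite -big_split; apply: eq_bigr => i _; rewrite mxE mulrDl. Qed.
Lemma dotZl k a c : dot (k *: a) c = k * dot a c.
Proof. by rewrite mulr_sumr; apply: eq_bigr => i _; rewrite mxE mulrA. Qed.
Lemma dot_delta i j : dot (delta_mx 0 i) (delta_mx 0 j) = (i == j)%:R.
Proof.
rewrite /dot (bigD1 i) //= big1 ?addr0 => [|k /negbTE ki].
  by rewrite !mxE !eqxx mul1r.
by rewrite !mxE ki andbF mul0r.
Qed.

Lemma bivector_mulmx a b c e i j :
  (so_val (bivector a b) *m so_val (bivector c e)) i j =
  a 0 i * e 0 j * dot b c - a 0 i * c 0 j * dot b e
  - b 0 i * e 0 j * dot a c + b 0 i * c 0 j * dot a e.
Proof.
rewrite /dot !mulr_sumr -!sumrB -big_split mxE; apply: eq_bigr => k _ /=.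
rewrite !bivectorE; ring.
Qed.

Lemma so_bracket_bivector a b c e :
  so_bracket (bivector a b) (bivector c e) =
  dot b c *: bivector a e - dot a c *: bivector b e
  - dot b e *: bivector a c + dot a e *: bivector b c.
Proof.
apply: so_ext => i j; rewrite so_val_bracket !bivector_mulmx.
rewrite !(so_valD, so_valN, so_valZ) !bivectorE.
rewrite (dotC c b) (dotC c a) (dotC e a) (dotC e b); ring.
Qed.

Lemma bivectorDl a b c : bivector (a + b) c = bivector a c + bivector b c.
Proof.
by apply: so_ext => i j; rewrite so_valD !bivectorE !mxE; ring.
Qed.
Lemma bivectorZl k a c : bivector (k *: a) c = k *: bivector a c.
Proof.
by apply: so_ext => i j; rewrite so_valZ !bivectorE !mxE; ring.
Qed.
Lemma bivectorC a b : bivector b a = - bivector a b.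
Proof.
by apply: so_ext => i j; rewrite so_valN !bivectorE; ring.
Qed.

(** The factor 1/2 compensates for summing over ordered pairs. *)
Lemma so_decomposition x :
  x = \sum_i \sum_j (so_val x i j / 2) *: bivector (delta_mx 0 i) (delta_mx 0 j).
Proof.
apply: so_ext => i j; rewrite so_val_sum.
transitivity (\sum_k \sum_l (so_val x k l / 2 * ((i == k) && (j == l))%:R
     - so_val x k l / 2 * ((i == l) && (j == k))%:R)); last first.
  apply: eq_bigr => k _; rewrite so_val_sum; apply: eq_bigr => l _.
  rewrite so_valZ bivectorE !mxE !eqxx /= -!natrM !mulnb mulrBr.
  by [].
have sumE (f : 'I_d -> 'I_d -> K) (p q : 'I_d) :
    \sum_k \sum_l f k l * ((p == k) && (q == l))%:R = f p q.
  rewrite (bigD1 p) //= [X in _ + X]big1 ?addr0 => [|k /negbTE kp]; last first.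
    by rewrite big1 // => l _; rewrite eq_sym kp mulr0.
  rewrite (bigD1 q) //= !eqxx mulr1 big1 ?addr0 // => l /negbTE lq.
  by rewrite eq_sym lq mulr0.
under eq_bigr do rewrite sumrB; rewrite sumrB sumE exchange_big /=.
rewrite (sumE (fun l k => so_val x k l / 2)) [so_val x j i]so_skew; by field.

Qed.

End So.

(** * The elements x_{a,b,c,d} *)

Section Pfaffian.
Variables (K : numClosedFieldType) (d : nat) (M : lmodType K).
Variables (rho : so K d -> M -> M) (rhoP : lie_module (@so_bracket K d) rho).
Local Notation V := 'rV[K]_d.
Implicit Types (a b c e p q : V) (x y : so K d) (z w : M) (k : K).

Lemma rhoDl x y z : rho (x + y) z = rho x z + rho y z.
Proof. by case: rhoP => rhoL _ _; rewrite -[x]scale1r rhoL !scale1r. Qed.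
Lemma rho0l z : rho 0 z = 0.
Proof. by apply: (@addIr _ (rho 0 z)); rewrite -rhoDl !add0r. Qed.
Lemma rhoZl k x z : rho (k *: x) z = k *: rho x z.
Proof. by case: rhoP => rhoL _ _; rewrite -[k *: x]addr0 rhoL rho0l addr0. Qed.
Lemma rhoNl x z : rho (- x) z = - rho x z.
Proof. by rewrite -(scaleN1r x) rhoZl scaleN1r. Qed.
Lemma rho_suml I (r : seq I) P (F : I -> so K d) z :
  rho (\sum_(i <- r | P i) F i) z = \sum_(i <- r | P i) rho (F i) z.
Proof.
by apply: (big_morph (fun x => rho x z)) => [x y|]; rewrite ?rhoDl ?rho0l.
Qed.
Lemma rhoDr x z w : rho x (z + w) = rho x z + rho x w.
Proof. by case: rhoP => _ rhoL _; rewrite -[z]scale1r rhoL !scale1r. Qed.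
Lemma rho0r x : rho x 0 = 0.
Proof. by apply: (@addIr _ (rho x 0)); rewrite -rhoDr !add0r. Qed.
Lemma rhoZr k x z : rho x (k *: z) = k *: rho x z.
Proof. by case: rhoP => _ rhoL _; rewrite -[k *: z]addr0 rhoL rho0r addr0. Qed.
Lemma rhoNr x z : rho x (- z) = - rho x z.
Proof. by rewrite -(scaleN1r z) rhoZr scaleN1r. Qed.
Lemma rho_sumr I (r : seq I) P (F : I -> M) x :
  rho x (\sum_(i <- r | P i) F i) = \sum_(i <- r | P i) rho x (F i).
Proof. by apply: (big_morph (rho x)) => [z w|]; rewrite ?rhoDr ?rho0r. Qed.
Lemma rho_bracket x y z : rho (so_bracket x y) z = rho x (rho y z) - rho y (rho x z).
Proof. by case: rhoP. Qed.

Definition rhob a b z := rho (bivector a b) z.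

Lemma rhobDl a b c z : rhob (a + b) c z = rhob a c z + rhob b c z.
Proof. by rewrite /rhob bivectorDl rhoDl. Qed.
Lemma rhobZl k a c z : rhob (k *: a) c z = k *: rhob a c z.
Proof. by rewrite /rhob bivectorZl rhoZl. Qed.
Lemma rhob_skew a b z : rhob b a z = - rhob a b z.
Proof. by rewrite /rhob bivectorC rhoNl. Qed.
Lemma rhobNl a c z : rhob (- a) c z = - rhob a c z.
Proof. by rewrite -(scaleN1r a) rhobZl scaleN1r. Qed.
Lemma rhobDr a b c z : rhob a (b + c) z = rhob a b z + rhob a c z.
Proof. by rewrite rhob_skew rhobDl opprD -!rhob_skew. Qed.
Lemma rhobZr k a c z : rhob a (k *: c) z = k *: rhob a c z.
Proof. by rewrite rhob_skew rhobZl -scalerN -rhob_skew. Qed.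
Lemma rhobNr a c z : rhob a (- c) z = - rhob a c z.
Proof. by rewrite -(scaleN1r c) rhobZr scaleN1r. Qed.
Lemma rhobDv a b z w : rhob a b (z + w) = rhob a b z + rhob a b w.
Proof. exact: rhoDr. Qed.
Lemma rhobZv a b k z : rhob a b (k *: z) = k *: rhob a b z.
Proof. exact: rhoZr. Qed.
Lemma rhobNv a b z : rhob a b (- z) = - rhob a b z.
Proof. exact: rhoNr. Qed.
Lemma rhob0v a b : rhob a b 0 = 0.
Proof. exact: rho0r. Qed.

Definition rhob_linE := (rhobDl, rhobZl, rhobNl, rhobDr, rhobZr, rhobNr).
Definition rhob_vE := (rhobDv, rhobZv, rhobNv, rhob0v).

Lemma rhob_comm a b c e z :
  rhob a b (rhob c e z) = rhob c e (rhob a b z)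
    + (dot b c *: rhob a e z - dot a c *: rhob b e z
       - dot b e *: rhob a c z + dot a e *: rhob b c z).
Proof.
have := rho_bracket (bivector a b) (bivector c e) z.
rewrite so_bracket_bivector !(rhoDl, rhoZl, rhoNl) => ->.
by rewrite addrC subrK.
Qed.

(* The action of [bivector p q] on the natural module. *)
Definition natural_act p q a : V := dot q a *: p - dot p a *: q.

Lemma rhob_natural p q a b z : rhob p q (rhob a b z) = rhob a b (rhob p q z)
  + rhob (natural_act p q a) b z + rhob a (natural_act p q b) z.
Proof.
rewrite rhob_comm /natural_act !rhob_linE (rhob_skew p a) (rhob_skew q a); module.
Qed.

Lemma dotDr a b c : dot c (a + b) = dot c a + dot c b.
Proof. by rewrite dotC dotDl !(dotC _ c). Qed.
Lemma dotZr k a c : dot c (k *: a) = k * dot c a.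
Proof. by rewrite dotC dotZl dotC. Qed.
Lemma dotNl a c : dot (- a) c = - dot a c.
Proof. by rewrite -(scaleN1r a) dotZl mulN1r. Qed.
Lemma dotNr a c : dot c (- a) = - dot c a.
Proof. by rewrite -(scaleN1r a) dotZr mulN1r. Qed.

Lemma dot_natural p q a b :
  dot (natural_act p q a) b = - dot a (natural_act p q b).
Proof.
rewrite /natural_act !(dotDl, dotDr, dotNl, dotNr, dotZl, dotZr).
rewrite (dotC a p) (dotC a q); ring.
Qed.

(* The action of x_{abce} = e^{ab}e^{ce} - e^{ac}e^{be} + e^{ae}e^{bc}, extended
   from four distinct basis vectors to arbitrary vectors; the lower order terms
   make it alternating. *)
Definition pfaffian a b c e z : M :=
  rhob a b (rhob c e z) - rhob a c (rhob b e z) + rhob a e (rhob b c z)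
  - (dot a b *: rhob c e z - dot a c *: rhob b e z + dot a e *: rhob b c z).

(** This is the swap that reverses the order of operators, in the second and third products; the
    resulting commutators are exactly what the lower order terms compensate. The other two adjacent
    swaps are formal. *)
Lemma pfaffian_swap12 a b c e z : pfaffian b a c e z = - pfaffian a b c e z.
Proof.
rewrite /pfaffian (rhob_comm b c a e) (rhob_comm b e a c).
rewrite !(rhob_skew a b, rhob_skew a c, rhob_skew a e, rhob_skew c e).
rewrite (dotC b a) (dotC c a) (dotC e a) (dotC e c) ?rhob_vE; module.
Qed.

Lemma pfaffian_swap23 a b c e z : pfaffian a c b e z = - pfaffian a b c e z.
Proof. by rewrite /pfaffian (rhob_skew b c) !rhob_vE; module. Qed.

Lemma pfaffian_swap34 a b c e z : pfaffian a b e c z = - pfaffian a b c e z.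
Proof. by rewrite /pfaffian (rhob_skew c e) !rhob_vE; module. Qed.

Lemma pfaffianB1 k l a a' b c e z : pfaffian (k *: a - l *: a') b c e z =
  k *: pfaffian a b c e z - l *: pfaffian a' b c e z.
Proof. by rewrite /pfaffian !rhob_linE !dotDl !dotNl !dotZl; module. Qed.
Lemma pfaffianB2 k l a b b' c e z : pfaffian a (k *: b - l *: b') c e z =
  k *: pfaffian a b c e z - l *: pfaffian a b' c e z.
Proof. by rewrite pfaffian_swap12 pfaffianB1 !(pfaffian_swap12 a); module. Qed.
Lemma pfaffianB3 k l a b c c' e z : pfaffian a b (k *: c - l *: c') e z =
  k *: pfaffian a b c e z - l *: pfaffian a b c' e z.
Proof. by rewrite pfaffian_swap23 pfaffianB2 !(pfaffian_swap23 a b); module. Qed.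
Lemma pfaffianB4 k l a b c e e' z : pfaffian a b c (k *: e - l *: e') z =
  k *: pfaffian a b c e z - l *: pfaffian a b c e' z.
Proof. by rewrite pfaffian_swap34 pfaffianB3 !(pfaffian_swap34 a b c); module. Qed.

Lemma pfaffianZ1 k a b c e z : pfaffian (k *: a) b c e z = k *: pfaffian a b c e z.
Proof. by have := pfaffianB1 k 0 a 0 b c e z; rewrite !scale0r !subr0. Qed.
Lemma pfaffianZ2 k a b c e z : pfaffian a (k *: b) c e z = k *: pfaffian a b c e z.
Proof. by have := pfaffianB2 k 0 a b 0 c e z; rewrite !scale0r !subr0. Qed.
Lemma pfaffianZ3 k a b c e z : pfaffian a b (k *: c) e z = k *: pfaffian a b c e z.
Proof. by have := pfaffianB3 k 0 a b c 0 e z; rewrite !scale0r !subr0. Qed.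
Lemma pfaffianZ4 k a b c e z : pfaffian a b c (k *: e) z = k *: pfaffian a b c e z.
Proof. by have := pfaffianB4 k 0 a b c e 0 z; rewrite !scale0r !subr0. Qed.

Lemma pfaffianDv a b c e z w :
  pfaffian a b c e (z + w) = pfaffian a b c e z + pfaffian a b c e w.
Proof. by rewrite /pfaffian !rhob_vE; module. Qed.
Lemma pfaffianZv a b c e k z :
  pfaffian a b c e (k *: z) = k *: pfaffian a b c e z.
Proof. by rewrite /pfaffian !rhob_vE; module. Qed.

(** Equivariance: [rhob] is equivariant in its two vectors and [dot] is invariant, so both the
    quadratic part and the lower order part are equivariant. This is the ad-invariance of the span
    of the x_{a,b,c,d}. *)
Lemma pfaffian_natural p q a b c e z :
  rhob p q (pfaffian a b c e z) = pfaffian a b c e (rhob p q z)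
  + (pfaffian (natural_act p q a) b c e z + pfaffian a (natural_act p q b) c e z
     + pfaffian a b (natural_act p q c) e z + pfaffian a b c (natural_act p q e) z).
Proof.
rewrite /pfaffian !rhob_vE !(rhob_natural p q) !rhob_vE.
rewrite !(dot_natural p q); move: (natural_act p q) => n.
module.
Qed.

Lemma self_opp_eq0 z : z = - z -> z = 0.
Proof.
move=> /eqP; rewrite -subr_eq0 opprK -mulr2n -scaler_nat scaler_eq0 pnatr_eq0.
by move=> /eqP.
Qed.

Lemma pfaffian12 a c e z : pfaffian a a c e z = 0.
Proof. by apply: self_opp_eq0; exact: pfaffian_swap12. Qed.
Lemma pfaffian23 a b e z : pfaffian a b b e z = 0.
Proof. by apply: self_opp_eq0; exact: pfaffian_swap23. Qed.
Lemma pfaffian34 a b c z : pfaffian a b c c z = 0.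
Proof. by apply: self_opp_eq0; exact: pfaffian_swap34. Qed.
Lemma pfaffian13 a b e z : pfaffian a b a e z = 0.
Proof. by rewrite pfaffian_swap23 pfaffian12 oppr0. Qed.
Lemma pfaffian24 a b c z : pfaffian a b c b z = 0.
Proof. by rewrite pfaffian_swap34 pfaffian23 oppr0. Qed.
End Pfaffian.

(** * Brackets with one entry in the module *)

Lemma replace_perm (n : nat) (T : Type) (s : 'S_n) i u (x : {ffun 'I_n -> T}) :
  replace i u [ffun k => x (s k)] = [ffun k => replace (s i) u x (s k)].
Proof. by apply/ffunP=> k; rewrite !ffunE (inj_eq perm_inj). Qed.

Lemma insert_replace (n : nat) (T : Type) (i : 'I_n) (u w : T) y :
  insert i u y = replace i u (insert i w y).
Proof. by rewrite replace_insert. Qed.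

Section Slots.
Variables (K : numClosedFieldType) (n : nat).
Local Notation V := 'rV[K]_n.+1.
Local Notation e a := (delta_mx 0 a : V).
Implicit Types (x : {ffun 'I_n -> V}) (y : {ffun 'I_n.-1 -> V}) (u w : V).
Implicit Types (S C : 'M[K]_n.+1).

(* The matrix of [x_1, .., u, .., x_n] as a function of the row vector u in slot k. *)
Definition slot_mx x (k : 'I_n) : 'M[K]_n.+1 :=
  \matrix_(b, a) simple_bracket (replace k (e b) x) 0 a.

Lemma slot_mxE x k b a :
  slot_mx x k b a = simple_bracket (replace k (e b) x) 0 a.
Proof. exact: mxE. Qed.

Lemma slot_mxP x k u : simple_bracket (replace k u x) = u *m slot_mx x k.
Proof.
rewrite simple_bracket_replaceE; apply/rowP=> a; rewrite summxE [RHS]mxE.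
by apply: eq_bigr => b _; rewrite [LHS]mxE slot_mxE.
Qed.

Lemma slot_mx_skew x k : (slot_mx x k)^T = - slot_mx x k.
Proof. by apply/matrixP=> a b; rewrite mxE [RHS]mxE !slot_mxE simple_bracket_skew. Qed.

Lemma slot_mx_replace x k u : slot_mx (replace k u x) k = slot_mx x k.
Proof. by apply/matrixP=> a b; rewrite !slot_mxE replaceK. Qed.

Lemma slot_mx_linear x i k c u w : i != k ->
  slot_mx (replace i (c *: u + w) x) k =
  c *: slot_mx (replace i u x) k + slot_mx (replace i w x) k.
Proof.
rewrite eq_sym => ki; apply/matrixP=> b a; rewrite [RHS]mxE [in RHS]mxE !slot_mxE.
by rewrite !(replaceC (e b) _ x ki) simple_bracket_multilinear [LHS]mxE [in LHS]mxE.
Qed.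

Lemma slot_mx_perm (s : 'S_n) x k :
  slot_mx [ffun l => x (s l)] k = (-1) ^+ s *: slot_mx x (s k).
Proof.
apply/matrixP=> b a; rewrite [RHS]mxE !slot_mxE.
by rewrite replace_perm simple_bracket_perm [LHS]mxE.
Qed.

(** A skew [S] has trace 0, so its derivation kills det (x_1, .., x_n, e_a). The term where [S] hits
    e_a is moved onto the bracket by skewness for the dot product. *)
Lemma simple_bracket_derivation S x : S^T = - S ->
  \sum_i simple_bracket (replace i (x i *m S) x) = simple_bracket x *m S.
Proof.
move=> Sskew; apply/rowP=> a; rewrite summxE.
have trS : \tr S = 0.
  by apply: (@self_opp_eq0 K K^o); rewrite -[LHS]mxtrace_tr Sskew linearN.
have := detr_derivation S (ext x (e a)).
rewrite trS mul0r (bigD1_ord ord_max) //= insert_self -(ext_max _ (e a)).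
rewrite -simple_bracket_dot => /eqP; rewrite addrC addr_eq0 => /eqP H.
transitivity (\sum_(i < n) detr (replace (lift ord_max i)
    (ext x (e a) (lift ord_max i) *m S) (ext x (e a)))).
  by apply: eq_bigr => i _; rewrite simple_bracketE ext_replace insert_lift.
rewrite H -sumrN [RHS]mxE; apply: eq_bigr => c _.
have -> : S c a = - S a c by rewrite -[in RHS](trmxK S) Sskew !mxE opprK.
rewrite mulrN; congr (- (_ * _)).
by rewrite -rowE mxE.
Qed.

(** The derivation property with e_b in slot [k]; the term i = k acts on e_b itself and becomes
    [S *m slot_mx x k]. *)
Lemma slot_mx_derivation S x k : S^T = - S ->
  \sum_(i | i != k) slot_mx (replace i (x i *m S) x) k =
  slot_mx x k *m S - S *m slot_mx x k.
Proof.
move=> Sskew; apply/row_matrixP=> b.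
have rowC z : row b (slot_mx z k) = simple_bracket (replace k (e b) z).
  by apply/rowP=> a; rewrite [LHS]mxE slot_mxE.
rewrite linear_sum /= (eq_bigr (fun i => simple_bracket (replace i (x i *m S)
    (replace k (e b) x)))); last first.
  by move=> i ik; rewrite rowC replaceC // eq_sym.
rewrite linearB /= !row_mul rowC -simple_bracket_derivation //.
rewrite -slot_mxP [in RHS](bigD1 k) //= replaceK replace_self -rowE.
rewrite addrAC subrr add0r; apply: eq_bigr => i ik.
by rewrite replace_neq.
Qed.

(** Bracketing with [y] is right multiplication by a skew matrix, so the identity is the derivation
    property of the cross product. *)
Lemma nLie_identity_simple_bracket : nLie_identity (@simple_bracket K n).
Proof.
move=> i0 x y _; rewrite (insert_replace _ _ 0) slot_mxP.
rewrite -simple_bracket_derivation ?slot_mx_skew //; apply: eq_bigr => i _.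
by rewrite (insert_replace i0 (x i) 0) (slot_mxP (insert i0 0 y)).
Qed.

Definition altvec (a : 'I_n.+1) : V := (-1) ^+ a *: e a.

Lemma altvecE a i : altvec a 0 i = (-1) ^+ a * (i == a)%:R.
Proof. by rewrite mxE [in LHS]mxE eqxx. Qed.

Lemma dot_altvec a b : dot (altvec a) (altvec b) = (a == b)%:R.
Proof.
rewrite dotZl dotZr dot_delta mulrA; case: eqP => [->|_]; last by rewrite mulr0.
by rewrite -expr2 sqrr_sign mulr1.
Qed.

(* Since e^{ij} is the wedge product of the remaining basis vectors without the
   sign (-1)^{i+j}, [wedge] is the equivariant map [slot_mx] conjugated by the
   diagonal matrix of the signs (-1)^i. *)
Definition twist C : so K n.+1 :=
  \sum_a \sum_b (C b a / 2) *: bivector (altvec a) (altvec b).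

Lemma twistE C i j : so_val (twist C) i j = (-1) ^+ (i + j) * ((C j i - C i j) / 2).
Proof.
rewrite /twist so_val_sum.
transitivity (\sum_a \sum_b (((C b a / 2) * (-1) ^+ (a + b)) * ((i == a) && (j == b))%:R
    - ((C b a / 2) * (-1) ^+ (a + b)) * ((j == a) && (i == b))%:R)).
  apply: eq_bigr => a _; rewrite so_val_sum; apply: eq_bigr => b _.
  rewrite so_valZ bivectorE !altvecE.
  rewrite (exprD _ a b) -!mulnb !natrM; ring.
have sumE (f : 'I_n.+1 -> 'I_n.+1 -> K) p q :
    \sum_a \sum_b f a b * ((p == a) && (q == b))%:R = f p q.
  rewrite (bigD1 p) //= [X in _ + X]big1 ?addr0 => [|a /negbTE ap]; last first.
    by rewrite big1 // => b _; rewrite eq_sym ap mulr0.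
  rewrite (bigD1 q) //= !eqxx mulr1 big1 ?addr0 // => b /negbTE bq.
  by rewrite eq_sym bq mulr0.
under eq_bigr do rewrite sumrB; rewrite sumrB.
rewrite (sumE (fun a b => C b a / 2 * (-1) ^+ (a + b))).
rewrite (sumE (fun a b => C b a / 2 * (-1) ^+ (a + b))).
by rewrite [in X in _ - X](addnC j) -mulrBl -mulrBl mulrC.
Qed.

Lemma twist_skewE C i j : C^T = - C ->
  so_val (twist C) i j = (-1) ^+ (i + j) * C j i.
Proof.
move=> Cskew; rewrite twistE; congr (_ * _).
have -> : C i j = - C j i by rewrite -[in RHS](trmxK C) Cskew !mxE opprK.
by field.
Qed.

Lemma twistD S C : twist (S + C) = twist S + twist C.
Proof. by apply: so_ext => i j; rewrite so_valD !twistE !mxE; ring. Qed.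
Lemma twist0 : twist 0 = 0.
Proof. by apply: (@addIr _ (twist 0)); rewrite -twistD !add0r. Qed.
Lemma twistZ c C : twist (c *: C) = c *: twist C.
Proof. by apply: so_ext => i j; rewrite so_valZ !twistE !mxE; ring. Qed.

Lemma twist_sum I (r : seq I) P (F : I -> 'M[K]_n.+1) :
  twist (\sum_(i <- r | P i) F i) = \sum_(i <- r | P i) twist (F i).
Proof. by apply: (big_morph twist) => [A B|]; rewrite ?twistD ?twist0. Qed.

(** On skew matrices [twist] is transposition followed by conjugation with signs, hence it reverses
    products. In [sgn] the sign of the summation index occurs twice and disappears. *)
Lemma twist_bracket S C : S^T = - S -> C^T = - C ->
  so_bracket (twist S) (twist C) = twist (C *m S - S *m C).
Proof.
move=> Ss Cs; apply: so_ext => i j; rewrite so_val_bracket twist_skewE; last first.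
  by rewrite linearB /= !trmx_mul Ss Cs !(mulmxN, mulNmx, opprK, opprB).
rewrite [(_ - _ : 'M_n.+1) j i]mxE [(- _ : 'M_n.+1) j i]mxE mulrBr !mxE !mulr_sumr.
have sgn (k : nat) (p q : K) : (-1) ^+ (i + k) * p * ((-1) ^+ (k + j) * q) =
    (-1) ^+ (i + j) * (q * p).
  rewrite !exprD; set s := (-1) ^+ k.
  have ss : s * s = 1 by rewrite -expr2 sqrr_sign.
  by rewrite -[RHS]mul1r -ss; ring.
congr (_ - _); apply: eq_bigr => k _; rewrite !twist_skewE // sgn //.
Qed.

End Slots.

(** * The wedge product as a twisted bracket matrix *)

Section Wedge.
Variable K : numClosedFieldType.

Lemma wedge_entry (n : nat) (y : {ffun 'I_n -> 'rV[K]_n.+2}) (a b : 'I_n.+2)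
    (c : 'I_n.+1) : (b < a)%N -> b = c :> nat ->
  so_val (wedge (y : {ffun 'I_n.+1.-1 -> 'rV[K]_n.+2})) a b =
  - \det (col' c (col' a (\matrix_(k < n) y k))).
Proof.
move=> ba bc; rewrite /wedge so_val_sum (bigD1 a) //= [X in _ + X]big1 ?addr0.
  rewrite so_val_sum (bigD1 c) /= -?bc //.
  have -> : widen_ord (leqnSn n.+1) c = b by apply/val_inj.
  rewrite [X in _ + X]big1 ?addr0 => [|i /andP[ia ic]].
    have /negbTE ab : a != b by rewrite -val_eqE /= gtn_eqF.
    by move: (\det _) => D; rewrite !mxE !eqxx ab sub0r mulrN1.
  have /negbTE bi : b != widen_ord (leqnSn n.+1) i.
    by apply: contra ic => /eqP/(congr1 val)/= bi; rewrite -val_eqE /= -bi bc.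
  have /negbTE ai : a != widen_ord (leqnSn n.+1) i by rewrite -val_eqE /= gtn_eqF.
  by move: (\det _) => D; rewrite !mxE ai bi andbF subrr mulr0.
move=> j ja; rewrite so_val_sum big1 // => i ij.
rewrite so_valZ so_unit_bivector bivectorE !mxE !eqxx /= [a == j]eq_sym.
rewrite (negbTE ja) mul0r subr0.
case: eqP => [/(congr1 val)/= ai|_]; last by rewrite mul0r mulr0.
case: eqP => [bj|_]; last by rewrite !mulr0.
by move: ij; rewrite -ai -bj ltnNge ltnW.
Qed.

Lemma simple_bracket_minor (n : nat) (y : {ffun 'I_n -> 'rV[K]_n.+2})
    (a : 'I_n.+2) (c : 'I_n.+1) :
  simple_bracket (insert (ord_max : 'I_n.+1) (delta_mx 0 (lift a c)) y) 0 a =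
  - (-1) ^+ (a + c) * \det (col' c (col' a (\matrix_(k < n) y k))).
Proof.
rewrite mxE (expand_det_row _ ord_max) (bigD1 c) //= [X in _ + X]big1 ?addr0.
  rewrite !mxE insert_self mxE !eqxx mul1r mulrA; congr (_ * _).
    have nn : (-1) ^+ n * (-1) ^+ n = 1 :> K by rewrite -expr2 sqrr_sign.
    by rewrite /= !exprD exprS -[RHS]mul1r -[X in _ = X * _]nn; ring.
  congr (\det _); apply/matrixP=> k l; rewrite !mxE insert_lift.
  by [].
move=> c' /negbTE cc'.
by rewrite !mxE insert_self mxE eqxx (inj_eq lift_inj) cc' mul0r.
Qed.

(** Below the diagonal both sides are the same maximal minor of [y]; the cofactor expansion of the
    bracket leaves the sign (-1)^(a+b), which [twist] cancels. Skewness gives the remaining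
    entries. *)
Lemma wedge_twist (n : nat) (last : 'I_n) (y : {ffun 'I_n.-1 -> 'rV[K]_n.+1}) :
  last = n.-1 :> nat -> wedge y = twist (slot_mx (insert last 0 y) last).
Proof.
case: n => [|n] in last y *; first by case: last.
move=> lastE; have -> : last = ord_max by apply/val_inj.
set T := slot_mx _ _; have Ts : T^T = - T by exact: slot_mx_skew.
have lower (a b : 'I_n.+2) : (b < a)%N -> so_val (wedge y) a b = (-1) ^+ (a + b) * T b a.
  move=> ba; have bn : (b < n.+1)%N by rewrite (leq_trans ba) // -ltnS.
  rewrite (@wedge_entry _ _ _ _ (Ordinal bn)) // slot_mxE replace_insert.
  have bE : b = lift a (Ordinal bn).
    by apply/val_inj; rewrite /= /bump leqNgt ba.
  rewrite [in RHS]bE simple_bracket_minor mulNr mulrN mulrA /=.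
  by rewrite /bump leqNgt ba add0n -exprD addnn -signr_odd odd_double mul1r.
apply: so_ext => a b; rewrite twist_skewE //.
case: (ltngtP b a) => [/lower //|ab|/val_inj->].
  rewrite so_skew lower // addnC -mulrN; congr (_ * _).
  by rewrite -[in RHS](trmxK T) Ts !mxE.
have diag0 c : c = - c -> c = 0 :> K by exact: (@self_opp_eq0 K K^o).
have -> : T a a = 0 by apply: diag0; rewrite -[in LHS](trmxK T) Ts mxE [in LHS]mxE.
by rewrite mulr0; apply: diag0; exact: so_skew.
Qed.

End Wedge.

(** * The module entry in an arbitrary slot *)

Section ModuleBracket.
Variables (K : numClosedFieldType) (n : nat) (M : lmodType K).
Variables (rho : so K n.+1 -> M -> M) (rhoP : lie_module (@so_bracket K n.+1) rho).
Local Notation V := 'rV[K]_n.+1.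
Local Notation e a := (delta_mx 0 a : V).
Implicit Types (x : {ffun 'I_n -> V}) (y : {ffun 'I_n.-1 -> V}) (u w : V) (m : M).

(* The bracket [x_1, .., m, .., x_n] with m in slot k. *)
Definition slot_act x k m := rho (twist (slot_mx x k)) m.

Lemma slot_actE x k m : slot_act x k m =
  \sum_a \sum_b (slot_mx x k b a / 2) *: rhob rho (altvec K a) (altvec K b) m.
Proof.
rewrite /slot_act /twist (rho_suml rhoP); apply: eq_bigr => a _.
by rewrite (rho_suml rhoP); apply: eq_bigr => b _; rewrite (rhoZl rhoP).
Qed.

Lemma slot_act_replace x k u m : slot_act (replace k u x) k m = slot_act x k m.
Proof. by rewrite /slot_act slot_mx_replace. Qed.

Lemma slot_act_perm (s : 'S_n) x k m :
  slot_act [ffun l => x (s l)] k m = (-1) ^+ s *: slot_act x (s k) m.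
Proof. by rewrite /slot_act slot_mx_perm twistZ (rhoZl rhoP). Qed.

Lemma slot_act_linear x i k c u w m : i != k ->
  slot_act (replace i (c *: u + w) x) k m =
  c *: slot_act (replace i u x) k m + slot_act (replace i w x) k m.
Proof.
by move=> ik; rewrite /slot_act slot_mx_linear // twistD twistZ (rhoDl rhoP) (rhoZl rhoP).
Qed.

(** The n-Lie identity with the module entry among x_1, .., x_n: the commutator of two operators of
    so(n+1) is computed by [twist_bracket], and [slot_mx_derivation] expands it over the slots. *)
Lemma slot_act_derivation (i0 : 'I_n) x y k m :
  slot_act (insert i0 0 y) i0 (slot_act x k m) =
  slot_act x k (slot_act (insert i0 0 y) i0 m) +
  \sum_(i | i != k) slot_act (replace i (simple_bracket (insert i0 (x i) y)) x) k m.
Proof.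
have skS := slot_mx_skew (insert i0 0 y) i0.
apply/eqP; rewrite addrC -subr_eq -(rho_bracket rhoP).
rewrite twist_bracket ?slot_mx_skew // -slot_mx_derivation // twist_sum.
rewrite (rho_suml rhoP); apply/eqP/eq_bigr => i ik.
by rewrite (insert_replace i0 (x i) 0) (slot_mxP (insert i0 0 y)).
Qed.

(* The failure of the n-Lie identity with a module element among the last n-1
   entries is a combination of the x_{a,b,c,d}. *)
Lemma slot_act_defect (i0 j : 'I_n) x y m : i0 != j ->
  \sum_i slot_act x i (slot_act (insert i0 (x i) y) j m) =
  slot_act (insert i0 (simple_bracket x) y) j m +
  \sum_a (simple_bracket x 0 a / 6) *: \sum_b \sum_c \sum_d
    simple_bracket (replace j (e d) (insert i0 (e b) y)) 0 c *:
    pfaffian rho (altvec K a) (altvec K b) (altvec K c) (altvec K d) m.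
Proof.
move=> i0j.
pose D b d c := simple_bracket (replace j (e d) (insert i0 (e b) y)) 0 c.
pose R a b m := rhob rho (altvec K a) (altvec K b) m.
pose bx a := simple_bracket x 0 a.
have Dlin u d c : slot_mx (insert i0 u y) j d c = \sum_b u 0 b * D b d c.
  rewrite slot_mxE (insert_replace i0 u 0) replaceC 1?eq_sym //.
  rewrite simple_bracket_replaceE summxE; apply: eq_bigr => b _.
  by rewrite mxE replaceC // replace_insert.
have Dcd b d c : D b d c = - D b c d by exact: simple_bracket_skew.
have Dbd b d c : D b d c = - D d b c.
  rewrite /D (insert_replace _ (e b) 0) (insert_replace _ (e d) 0).
  by rewrite simple_bracket_swap 1?eq_sym // [LHS]mxE.
(* The pfaffian is an alternating sum of three copies of [H]. Paired with [D], which alternates in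
   its three indices, the copies agree; hence the factor 3, which leaves 3/6 = 1/2. *)
pose H a b c d : M := R a b (R c d m) - (a == b)%:R *: R c d m.
have pfE a b c d : pfaffian rho (altvec K a) (altvec K b) (altvec K c) (altvec K d) m
    = H a b c d - H a c b d + H a d b c.
  by rewrite /pfaffian /H !dot_altvec /R; module.
have sumpf a : \sum_b \sum_c \sum_d D b d c *:
    pfaffian rho (altvec K a) (altvec K b) (altvec K c) (altvec K d) m
    = 3 *: \sum_b \sum_c \sum_d D b d c *: H a b c d.
  transitivity (\sum_b \sum_c \sum_d D b d c *: H a b c d
    - \sum_b \sum_c \sum_d D b d c *: H a c b d
    + \sum_b \sum_c \sum_d D b d c *: H a d b c).
    rewrite -sumrB -big_split; apply: eq_bigr => b _.
    rewrite -sumrB -big_split; apply: eq_bigr => c _.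
    rewrite -sumrB -big_split; apply: eq_bigr => d _.
    by rewrite pfE scalerDr scalerBr.
  have -> : \sum_b \sum_c \sum_d D b d c *: H a c b d =
            - \sum_b \sum_c \sum_d D b d c *: H a b c d.
    rewrite exchange_big -sumrN; apply: eq_bigr => b _.
    rewrite -sumrN; apply: eq_bigr => c _; rewrite -sumrN; apply: eq_bigr => d _.
    by rewrite -scaleNr Dbd Dcd opprK Dbd.
  have -> : \sum_b \sum_c \sum_d D b d c *: H a d b c =
            \sum_b \sum_c \sum_d D b d c *: H a b c d.
    under eq_bigr do rewrite exchange_big.
    rewrite exchange_big; apply: eq_bigr => b _; apply: eq_bigr => c _.
    by apply: eq_bigr => d _; rewrite Dcd Dbd opprK Dcd [in RHS]Dbd.
  by module.
(* Each of the two nested actions contributes 1/2, hence 1/4. Once the sum over [i] is moved inside,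
   Cramer's rule evaluates it. *)
have innerE : \sum_i slot_act x i (slot_act (insert i0 (x i) y) j m) =
    \sum_a \sum_b \sum_c \sum_d ((bx a * D b d c - bx b * D a d c) / 4) *:
      R a b (R c d m).
  transitivity (\sum_i \sum_a \sum_b \sum_c \sum_d
     (slot_mx x i b a * slot_mx (insert i0 (x i) y) j d c / 4) *: R a b (R c d m)).
    apply: eq_bigr => i _; rewrite slot_actE; apply: eq_bigr => a _.
    apply: eq_bigr => b _; rewrite slot_actE /rhob (rho_sumr rhoP) scaler_sumr.
    apply: eq_bigr => c _; rewrite (rho_sumr rhoP) scaler_sumr.
    apply: eq_bigr => d _; rewrite (rhoZr rhoP) scalerA; congr (_ *: _).
    by field.
  rewrite exchange_big; apply: eq_bigr => a _.
  rewrite exchange_big; apply: eq_bigr => b _.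
  rewrite exchange_big; apply: eq_bigr => c _.
  rewrite exchange_big; apply: eq_bigr => d _.
  rewrite -scaler_suml -mulr_suml; congr (_ / _ *: _).
  transitivity (\sum_k (\sum_i slot_mx x i b a *: x i) 0 k * D k d c).
    rewrite (eq_bigr (fun i => \sum_k slot_mx x i b a * x i 0 k * D k d c)).
      rewrite exchange_big; apply: eq_bigr => k _.
      by rewrite summxE mulr_suml; apply: eq_bigr => i _; congr (_ * _); rewrite [RHS]mxE.
    by move=> i _; rewrite Dlin mulr_sumr; apply: eq_bigr => k _; rewrite mulrA.
  rewrite (eq_bigr (fun i => simple_bracket (replace i (e b) x) 0 a *: x i)); last first.
    by move=> i _; rewrite slot_mxE.
  rewrite simple_bracket_cramer -/(bx a) -/(bx b).
  transitivity (\sum_k (bx a * (e b 0 k * D k d c) - bx b * (e a 0 k * D k d c))).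
    apply: eq_bigr => k _; move: (e a) (e b) => u w; rewrite !mxE; ring.
  have sumd p : \sum_k (e p 0 k * D k d c) = D p d c.
    rewrite (bigD1 p) //= big1 ?addr0 => [|k /negbTE kp]; first by rewrite mxE !eqxx mul1r.
    by rewrite mxE kp andbF mul0r.
  by rewrite sumrB -!mulr_sumr !sumd.
have outerE : slot_act (insert i0 (simple_bracket x) y) j m =
    \sum_a \sum_b \sum_c \sum_d (bx a * D b d c / 2) *: ((a == b)%:R *: R c d m).
  rewrite slot_actE.
  transitivity (\sum_c \sum_d \sum_a (bx a * D a d c / 2) *: R c d m).
    apply: eq_bigr => c _; apply: eq_bigr => d _; rewrite Dlin.
    by rewrite mulr_suml scaler_suml.
  rewrite [RHS](eq_bigr (fun a => \sum_c \sum_d (bx a * D a d c / 2) *: R c d m)).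
    rewrite [RHS]exchange_big; apply: eq_bigr => c _ /=.
    by rewrite exchange_big.
  move=> a _; rewrite (bigD1 a) //= [X in _ + X]big1 ?addr0.
    by apply: eq_bigr => c _; apply: eq_bigr => d _; rewrite eqxx scale1r.
  move=> b /negbTE ba; apply: big1 => c _; apply: big1 => d _.
  by rewrite eq_sym ba scale0r scaler0.
rewrite innerE outerE.
(* Exchanging [a] and [b] in the subtracted half flips the sign of [R a b], so both halves agree and
   1/4 becomes 1/2. *)
transitivity (\sum_a \sum_b \sum_c \sum_d (bx a * D b d c / 2) *: R a b (R c d m)).
  transitivity (\sum_a \sum_b \sum_c \sum_d ((bx a * D b d c / 4) *: R a b (R c d m)) +
    \sum_a \sum_b \sum_c \sum_d ((bx a * D b d c / 4) *: R a b (R c d m))); last first.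
    rewrite -big_split; apply: eq_bigr => a _; rewrite -big_split; apply: eq_bigr => b _.
    rewrite -big_split; apply: eq_bigr => c _; rewrite -big_split; apply: eq_bigr => d _.
    by rewrite /= -scalerDl; congr (_ *: _); field.
  rewrite [X in _ + X]exchange_big.
  rewrite -big_split; apply: eq_bigr => a _; rewrite -big_split; apply: eq_bigr => b _.
  rewrite -big_split; apply: eq_bigr => c _; rewrite -big_split; apply: eq_bigr => d _.
  rewrite /= /R (rhob_skew rhoP (altvec K a) (altvec K b)); move: (rhob _ (altvec K a) _ _) => z.
  by rewrite scalerN -scaleNr -scalerDl; congr (_ *: _); ring.
rewrite -big_split; apply: eq_bigr => a _ /=.
rewrite sumpf scalerA scaler_sumr -big_split; apply: eq_bigr => b _ /=.
rewrite scaler_sumr -big_split; apply: eq_bigr => c _ /=.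
rewrite scaler_sumr -big_split; apply: eq_bigr => d _ /=.
rewrite scalerA /H.
have -> : simple_bracket x 0 a / 6 * 3 * D b d c = bx a * D b d c / 2.
  by rewrite /bx; field.
by rewrite scalerBr addrC subrK.
Qed.

End ModuleBracket.

(** * n-Lie modules of the simple n-Lie algebra *)

Section PfaffianSpan.
Variables (K : numClosedFieldType) (d : nat) (M : lmodType K).
Variables (rho : so K d -> M -> M) (rhoP : lie_module (@so_bracket K d) rho).
Local Notation V := 'rV[K]_d.
Variables (I : finType) (F : I -> V) (z : M).
Hypothesis F_span : forall a, exists c : I -> K, a = \sum_i c i *: F i.

Lemma pfaffian_span1 a b c e :
  (forall i, pfaffian rho (F i) b c e z = 0) -> pfaffian rho a b c e z = 0.
Proof.
move=> F0; have [k ->] := F_span a.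
apply: (big_ind (fun v => pfaffian rho v b c e z = 0)) => [|u v u0 v0|i _].
- by have := pfaffianZ1 rhoP 0 0 b c e z; rewrite !scale0r.
- have := pfaffianB1 rhoP 1 (- 1) u v b c e z.
  by rewrite !scaleN1r !opprK !scale1r u0 v0 addr0.
- by rewrite (pfaffianZ1 rhoP) F0 scaler0.
Qed.

(** Each argument in turn is moved to the front by adjacent swaps, expanded there and moved back. *)
Lemma pfaffian_span :
  (forall i j k l, pfaffian rho (F i) (F j) (F k) (F l) z = 0) ->
  forall a b c e, pfaffian rho a b c e z = 0.
Proof.
move=> F0 a b c e.
have s12 := pfaffian_swap12 rhoP; have s23 := pfaffian_swap23 rhoP.
have s34 := pfaffian_swap34 rhoP.
have F1 j k l u : pfaffian rho u (F j) (F k) (F l) z = 0 by exact: pfaffian_span1.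
have F2 k l u v : pfaffian rho u v (F k) (F l) z = 0.
  by rewrite s12 pfaffian_span1 ?oppr0 // => i; rewrite s12 F1 oppr0.
have F3 l u v w : pfaffian rho u v w (F l) z = 0.
  by rewrite s23 s12 opprK; apply: pfaffian_span1 => i; rewrite s12 s23 F2 !oppr0.
rewrite s34 s23 s12 opprK pfaffian_span1 ?oppr0 // => i.
by rewrite s12 s23 s34 F3 !oppr0.
Qed.

End PfaffianSpan.

Section ModuleStructure.
Variables (K : numClosedFieldType) (n : nat) (M : lmodType K).
Variables (rho : so K n.+1 -> M -> M) (rhoP : lie_module (@so_bracket K n.+1) rho).
Local Notation V := 'rV[K]_n.+1.
Local Notation e a := (delta_mx 0 a : V).
Local Notation slot_act := (slot_act rho).

Definition firsts (m : nat) (z : {ffun 'I_m -> V * M}) := [ffun k => (z k).1].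

(** The only candidate: in a multilinear expansion the terms with two or more module entries vanish,
    and those with exactly one are given by [slot_act]. *)
Definition module_bracket (z : {ffun 'I_n -> V * M}) : V * M :=
  (simple_bracket (firsts z), \sum_i slot_act (firsts z) i (z i).2).

Lemma firsts_replace m i p (z : {ffun 'I_m -> V * M}) :
  firsts (replace i p z) = replace i p.1 (firsts z).
Proof. by apply/ffunP=> k; rewrite !ffunE; case: eqP. Qed.

Lemma firsts_insert m (i : 'I_m) p (y : {ffun 'I_m.-1 -> V * M}) :
  firsts (insert i p y) = insert i p.1 (firsts y).
Proof. by apply/ffunP=> k; rewrite !ffunE; case: unlift => // l; rewrite ffunE. Qed.

Lemma module_bracket_multilinear : multilinear module_bracket.
Proof.
move=> i c u v z; rewrite /module_bracket !firsts_replace.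
apply: injective_projections => /=; first exact: simple_bracket_multilinear.
rewrite scaler_sumr -big_split; apply: eq_bigr => k _ /=.
have [->|ki] := eqVneq k i.
  by rewrite !replace_self !slot_act_replace /slot_act (rhoDr rhoP) (rhoZr rhoP).
by rewrite !(replace_neq _ _ ki) (slot_act_linear rhoP) // eq_sym.
Qed.

Lemma module_bracket_antisymmetric : antisymmetric_bracket module_bracket.
Proof.
move=> s z; have fE : firsts [ffun k => z (s k)] = [ffun k => firsts z (s k)].
  by apply/ffunP=> k; rewrite !ffunE.
apply: injective_projections; rewrite /= fE; first exact: simple_bracket_perm.
rewrite scaler_sumr [RHS](reindex_inj (@perm_inj _ s)) /=.
by apply: eq_bigr => k _; rewrite (slot_act_perm rhoP) ffunE.
Qed.

Lemma module_bracket_insert (i0 : 'I_n) p (y : {ffun 'I_n.-1 -> V * M}) :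
  (module_bracket (insert i0 p y)).2 = slot_act (insert i0 0 (firsts y)) i0 p.2 +
  \sum_j slot_act (insert i0 p.1 (firsts y)) (lift i0 j) (y j).2.
Proof.
rewrite /= firsts_insert (bigD1_ord i0) //=; congr (_ + _).
  by rewrite insert_self (insert_replace i0 p.1 0) slot_act_replace.
by apply: eq_bigr => j _; rewrite insert_lift.
Qed.

Lemma module_bracket_nLie_identity :
  (forall a b c d m, pfaffian rho a b c d m = 0) -> nLie_identity module_bracket.
Proof.
move=> pf0 i0 x y i00; apply: injective_projections.
  rewrite [LHS]/= firsts_insert /= nLie_identity_simple_bracket //.
  rewrite (big_morph fst (fun _ _ => erefl) erefl); apply: eq_bigr => i _ /=.
  by rewrite firsts_replace /= firsts_insert ffunE.
rewrite module_bracket_insert (big_morph snd (fun _ _ => erefl) erefl).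
set x1 := firsts x; set y1 := firsts y; set S := slot_act (insert i0 0 y1) i0.
pose ad i := simple_bracket (insert i0 (x1 i) y1).
(* For each [i] the three parts carry the module entry of [x i], of some [y j], and of some [x k]
   with k distinct from i. The first and third together give the derivation identity, the second the
   defect formula. *)
transitivity (\sum_i (slot_act x1 i (S (x i).2)
    + \sum_j slot_act x1 i (slot_act (insert i0 (x1 i) y1) (lift i0 j) (y j).2)
    + \sum_(k | k != i) slot_act (replace i (ad i) x1) k (x k).2)); last first.
  apply: eq_bigr => i _; rewrite [RHS](bigD1 i) //=; congr (_ + _).
    rewrite replace_self module_bracket_insert firsts_replace slot_act_replace.
    by rewrite /slot_act (rhoDr rhoP) (rho_sumr rhoP) ffunE.
  have adE : (module_bracket (insert i0 (x i) y)).1 = ad i.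
    by rewrite /= firsts_insert /ad /x1 [in RHS]ffunE.
  by apply: eq_bigr => k ki; rewrite firsts_replace adE (replace_neq _ _ ki).
rewrite !big_split /= addrAC; congr (_ + _); last first.
  rewrite exchange_big; apply: eq_bigr => j _ /=.
  rewrite (slot_act_defect rhoP) ?neq_lift // [X in _ = _ + X]big1 ?addr0 // => a _.
  rewrite big1 ?scaler0 // => b _; rewrite big1 // => c _; rewrite big1 // => d _.
  by rewrite pf0 scaler0.
have -> : \sum_i \sum_(k | k != i) slot_act (replace i (ad i) x1) k (x k).2 =
    \sum_k \sum_(i | i != k) slot_act (replace i (ad i) x1) k (x k).2.
  rewrite (exchange_big_dep predT) //=; apply: eq_bigr => k _.
  by apply: eq_bigl => i; rewrite eq_sym.
have -> : S (module_bracket x).2 = \sum_k S (slot_act x1 k (x k).2).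
  exact: (rho_sumr rhoP).
by rewrite -big_split; apply: eq_bigr => k _; rewrite /S (slot_act_derivation rhoP).
Qed.

Lemma module_bracket_nLie_module :
  (forall a b c d m, pfaffian rho a b c d m = 0) ->
  nLie_module (@simple_bracket K n) module_bracket.
Proof.
have slot0 x k : slot_act x k 0 = 0 by exact: (rho0r rhoP).
have br0 (z : {ffun 'I_n -> V * M}) i : (z i).1 = 0 -> simple_bracket (firsts z) = 0.
  move=> zi0; rewrite -(replace_id i (firsts z)) ffunE zi0 slot_mxP mul0mx //.
move=> pf0; split.
- split; [exact: module_bracket_multilinear | exact: module_bracket_antisymmetric|].
  exact: module_bracket_nLie_identity.
- move=> x; have fE : firsts [ffun k => (x k, 0)] = x.
    by apply/ffunP=> k; rewrite !ffunE.
  by rewrite /module_bracket fE big1 // => i _; rewrite ffunE slot0.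
- by move=> z i /br0.
- move=> z i j ij zi zj; rewrite /module_bracket (br0 _ i) // big1 // => k _.
  have act0 l : l != k -> (z l).1 = 0 -> slot_act (firsts z) k (z k).2 = 0.
    move=> lk zl; rewrite -(replace_id l (firsts z)) ffunE zl.
    have := slot_act_linear rhoP (firsts z) 1 0 0 (z k).2 lk.
    by rewrite scaler0 addr0 scale1r => /eqP; rewrite -subr_eq subrr eq_sym => /eqP.
  have [ik|] := eqVneq i k; last by move/act0; apply.
  by apply: act0 zj; rewrite eq_sym -ik.
Qed.

Lemma module_bracket_induced :
  (forall a b c d m, pfaffian rho a b c d m = 0) ->
  induced_bracket rho module_bracket.
Proof.
move=> pf0; split=> [|last x m lastE]; first exact: module_bracket_nLie_module.
have fE : firsts [ffun k => (x k, 0 : M)] = x by apply/ffunP=> k; rewrite !ffunE.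
apply: injective_projections.
  by rewrite /= firsts_insert fE (insert_replace _ _ 0) slot_mxP mul0mx.
rewrite module_bracket_insert big1 ?addr0 => [|j _]; last by rewrite ffunE; exact: (rho0r rhoP).
by rewrite fE /= (wedge_twist _ lastE).
Qed.

End ModuleStructure.

Lemma perm_through3 (T : finType) (i j k q s r : T) :
  [&& i != j, i != k & j != k] -> [&& q != s, q != r & s != r] ->
  exists p : {perm T}, [/\ p i = q, p j = s & p k = r].
Proof.
move=> /and3P[ij ik jk] /and3P[qs qr sr].
pose p1 := tperm i q; pose p2 := (p1 * tperm (p1 j) s)%g.
have p2i : p2 i = q.
  have p1j : p1 j != q by rewrite -[X in _ != X](tpermL i q) (inj_eq perm_inj) eq_sym.
  by rewrite permM tpermL tpermD // eq_sym.
have p2j : p2 j = s by rewrite permM tpermL.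
have pk l : l != k -> p2 k != p2 l by rewrite (inj_eq perm_inj) eq_sym.
exists (p2 * tperm (p2 k) r)%g.
split; rewrite permM ?tpermL // tpermD ?pk ?p2i ?p2j //; by rewrite eq_sym.
Qed.

Lemma sum3 (V : zmodType) (I : finType) (F : I -> V) q r s :
  [&& q != r, q != s & r != s] ->
  (forall i, i != q -> i != r -> i != s -> F i = 0) ->
  \sum_i F i = F q + F r + F s.
Proof.
move=> /and3P[qr qs rs] F0; rewrite (bigD1 q) //= (bigD1 r) 1?eq_sym //=.
rewrite (bigD1 s) /=; last by rewrite ![s == _]eq_sym qs.
by rewrite big1 ?addr0 ?addrA // => i /andP[/andP[iq ir] is']; exact: F0.
Qed.

(** * Necessity: isolating a single x_{a,b,c,d} *)

Section Necessity.
Variables (K : numClosedFieldType) (n : nat) (M : lmodType K).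
Variables (rho : so K n.+1 -> M -> M) (rhoP : lie_module (@so_bracket K n.+1) rho).
Local Notation V := 'rV[K]_n.+1.
Local Notation e a := (delta_mx 0 a : V).
Local Notation slot_act := (slot_act rho).
Local Notation pf a b c d m :=
  (pfaffian rho (altvec K a) (altvec K b) (altvec K c) (altvec K d) m).

Lemma altvec_span (a : V) : exists c : 'I_n.+1 -> K, a = \sum_i c i *: altvec K i.
Proof.
exists (fun i : 'I_n.+1 => (-1) ^+ i * a 0 i); rewrite [LHS]row_sum_delta.
by apply: eq_bigr => i _; rewrite scalerA mulrAC -expr2 sqrr_sign mul1r.
Qed.

Lemma pfaffian_altvec0 :
  (forall a b c d m, pf a b c d m = 0) ->
  forall a b c d m, pfaffian rho a b c d m = 0.
Proof.
move=> pf0 a b c d m; apply: (pfaffian_span rhoP altvec_span) => i j k l; exact: pf0.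
Qed.

(** [star] makes the defect sum vanish. Taking for [x] the basis without e_p leaves only a = p.
    Outside slot [j] the entries of [y] are the basis vectors other than e_q, e_r, e_s, so only
    permutations of q, r, s survive among b, c, d. The six terms agree because [D] and the pfaffian
    both alternate. *)
Lemma pfaffian_necessary (i0 j : 'I_n) : i0 != j ->
  (forall x y m, slot_act (insert i0 (simple_bracket x) y) j m =
     \sum_i slot_act x i (slot_act (insert i0 (x i) y) j m)) ->
  forall a b c d m, pfaffian rho a b c d m = 0.
Proof.
move=> i0j star; apply: pfaffian_altvec0 => p q r s m.
have [<-|qr] := eqVneq q r; first exact: pfaffian23.
have [<-|rs] := eqVneq r s; first exact: pfaffian34.
have [<-|qs] := eqVneq q s; first exact: pfaffian24.
have pos : [&& lift ord_max i0 != lift ord_max j, lift ord_max i0 != ord_max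
             & lift ord_max j != ord_max].
  by rewrite (inj_eq lift_inj) i0j ![_ == ord_max]eq_sym !neq_lift.
have [|sg [sgi sgj sgm]] := perm_through3 pos (_ : [&& q != s, q != r & s != r]).
  by rewrite qs qr eq_sym.
pose y : {ffun 'I_n.-1 -> V} := [ffun k => e (sg (lift ord_max (lift i0 k)))].
pose D b d c := simple_bracket (replace j (e d) (insert i0 (e b) y)) 0 c.
pose phi b c d := D b d c *: pf p b c d m.
have Dcd b d c : D b d c = - D b c d by exact: simple_bracket_skew.
have Dbd b d c : D b d c = - D d b c.
  rewrite /D (insert_replace _ (e b) 0) (insert_replace _ (e d) 0).
  by rewrite simple_bracket_swap 1?eq_sym // [LHS]mxE.
have D0 b d c : b != q -> b != r -> b != s -> D b d c = 0.
  move=> bq br bs; rewrite /D simple_bracketE.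
  have [k bk] : exists k, b = sg k by exists ((sg^-1)%g b); rewrite permKV.
  have [k' kE|kmax] := unliftP ord_max k; last by rewrite bk kmax sgm eqxx in br.
  have [k'' k'E|k'i] := unliftP i0 k'; last by rewrite bk kE k'i sgi eqxx in bq.
  apply: (@detr_alt _ _ _ (lift ord_max i0) (lift ord_max (lift i0 k''))).
    by rewrite (inj_eq lift_inj) neq_lift.
  have k'j : k' != j by apply: contraNneq bs => k'j; rewrite bk kE k'j sgj.
  rewrite !insert_lift !replace_neq -?k'E // insert_self k'E insert_lift ffunE.
  by rewrite bk kE k'E.
have phi12 b c d : phi b c d = phi c b d.
  rewrite /phi (pfaffian_swap23 rhoP) scalerN -scaleNr; congr (_ *: _).
  by rewrite Dbd opprK Dcd [in RHS]Dbd.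
have phi23 b c d : phi b c d = phi b d c.
  by rewrite /phi (pfaffian_swap34 rhoP) scalerN -scaleNr; congr (_ *: _); rewrite Dcd opprK.
have phi0 b c d : b != q -> b != r -> b != s -> phi b c d = 0.
  by move=> *; rewrite /phi D0 // scale0r.
have phi_bb b d : phi b b d = 0 by rewrite /phi (pfaffian23 rhoP) scaler0.
have phi_b_b b d : phi b d b = 0 by rewrite phi23.
have phi__bb b d : phi d b b = 0 by rewrite phi12.
have qrs : [&& q != r, q != s & r != s] by rewrite qr qs.
have sumphi : \sum_b \sum_c \sum_d phi b c d = 6 *: phi q r s.
  have sum_d b c : \sum_d phi b c d = phi b c q + phi b c r + phi b c s.
    by apply: sum3 => // d *; rewrite phi23 phi12 phi0.
  have sum_c b : \sum_c \sum_d phi b c d =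
      \sum_d phi b q d + \sum_d phi b r d + \sum_d phi b s d.
    by apply: sum3 => // c *; rewrite big1 // => d _; rewrite phi12 phi0.
  rewrite (sum3 qrs) ?sum_c ?sum_d; last first.
    by move=> b *; rewrite !big1 // => c _; rewrite !big1 // => d _; rewrite phi0.
  rewrite !(phi_bb, phi_b_b, phi__bb).
  rewrite (phi23 q s r) (phi12 r q s) (phi23 r s q) (phi12 r q s).
  by rewrite (phi12 s q r) (phi23 q s r) (phi23 s r q) (phi12 s q r) (phi23 q s r); module.
have := slot_act_defect rhoP [ffun k => e (lift p k)] y m i0j.
rewrite -star -[LHS]addr0 => /addrI/esym/eqP; rewrite simple_bracket_basis.
rewrite (bigD1 p) //= [X in _ + X]big1 ?addr0 => [|a /negbTE ap]; last first.
  by rewrite !mxE ap andbF mulr0 mul0r scale0r.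
rewrite !mxE !eqxx mulr1 sumphi scalerA -mulrA mulVf ?pnatr_eq0 // mulr1.
rewrite scaler_eq0 signr_eq0 /= /phi scaler_eq0 => /orP[|/eqP //].
(* For b, d, c = q, s, r the rows are the standard basis permuted by [sg], so [D q s r] is a sign,
   in particular nonzero. *)
rewrite /D simple_bracketE (_ : ext _ _ = [ffun k => [ffun l => e l] (sg k)]).
  rewrite detr_perm mulf_eq0 signr_eq0 /= /detr.
  rewrite [X in \det X](_ : _ = 1%:M) ?det1 ?oner_eq0 //.
  by apply/matrixP=> a b; rewrite !mxE ffunE mxE eqxx eq_sym.
apply/ffunP=> k; rewrite !ffunE; case: unliftP => [k' ->|->]; last by rewrite sgm.
rewrite ffunE; case: eqP => [->|/eqP k'j]; first by rewrite sgj.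
by rewrite ffunE; case: unliftP => [k'' ->|->]; rewrite ?ffunE ?sgi.
Qed.

(** [induced_bracket] prescribes the action in the last slot. A transposition moves the module entry
    there, and both sides pick up the same sign. *)
Lemma induced_bracket_slot br (x : {ffun 'I_n -> V}) i m : induced_bracket rho br ->
  br (replace i (0, m) [ffun k => (x k, 0)]) = (0, slot_act x i m).
Proof.
move=> [[[brL brA _] _ _ _] br_last].
have n_gt0 : (n.-1 < n)%N by rewrite prednK // (leq_ltn_trans _ (ltn_ord i)).
pose l : 'I_n := Ordinal n_gt0.
have lastE (x' : {ffun 'I_n -> V}) : br (replace l (0, m) [ffun k => (x' k, 0)]) = (0, slot_act x' l m).
  have -> : replace l (0, m) [ffun k => (x' k, 0)] =
      insert l (0, m) [ffun k => ([ffun k' => x' (lift l k')] k, 0)].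
    apply/ffunP=> k; rewrite !ffunE; case: (unliftP l k) => [k' ->|->].
      by rewrite eq_sym (negbTE (neq_lift _ _)) !ffunE.
    by rewrite eqxx.
  have E : insert l 0 [ffun k' => x' (lift l k')] = replace l 0 x'.
    apply/ffunP=> k; rewrite !ffunE; case: (unliftP l k) => [k' ->|->].
      by rewrite eq_sym (negbTE (neq_lift _ _)) ffunE.
    by rewrite eqxx.
  rewrite br_last // (wedge_twist _ (_ : l = n.-1 :> nat)) // E.
  by rewrite -(slot_act_replace rho x' l 0).
pose s := tperm i l.
have := brA s (replace i (0, m) [ffun k => (x k, 0)]).
have -> : [ffun k => replace i (0, m) [ffun k => (x k, 0)] (s k)] =
    replace l (0, m) [ffun k => ([ffun k => x (s k)] k, 0)].
  by apply/ffunP=> k; rewrite !ffunE -[X in _ == X](tpermR i l) (inj_eq perm_inj).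
rewrite lastE (slot_act_perm rhoP) tpermR => E.
rewrite -[LHS]scale1r -[X in X *: _](sqrr_sign _ s) expr2 -scalerA -E.
by apply: injective_projections; rewrite /= ?scaler0 // scalerA -expr2 sqrr_sign scale1r.
Qed.

Lemma induced_bracket_pfaffian br : (2 < n)%N -> induced_bracket rho br ->
  forall a b c d m, pfaffian rho a b c d m = 0.
Proof.
move=> n_gt2 brP; have n_gt0 : (0 < n)%N by rewrite (ltn_trans _ n_gt2).
have n1_gt0 : (0 < n.-1)%N by rewrite -ltnS prednK // ltnW.
pose i0 : 'I_n := Ordinal n_gt0; pose j' : 'I_n.-1 := Ordinal n1_gt0.
apply: (@pfaffian_necessary i0 (lift i0 j')); first exact: neq_lift.
move=> x y m; have [[[_ _ brI] brV _ _] _] := brP.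
(* The module element is placed first among the last n-1 arguments, which is slot [lift i0 j'] of
   the outer bracket. *)
have := brI i0 [ffun k => (x k, 0)] (replace j' (0, m) [ffun k => (y k, 0)]) erefl.
have insE u : insert i0 (u, 0) (replace j' (0, m) [ffun k => (y k, 0)]) =
    replace (lift i0 j') (0, m) [ffun k => (insert i0 u y k, 0)].
  apply/ffunP=> k; rewrite !ffunE; case: (unliftP i0 k) => [k' ->|->].
    by rewrite !ffunE (inj_eq lift_inj).
  by rewrite (negbTE (neq_lift _ _)).
rewrite brV insE (induced_bracket_slot _ _ _ brP) => /(congr1 snd) /= ->.
rewrite (big_morph snd (fun _ _ => erefl) erefl); apply: eq_bigr => i _.
by rewrite ffunE insE (induced_bracket_slot _ _ _ brP) (induced_bracket_slot _ _ _ brP).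
Qed.

(** The irreducibility notions match because a subspace stable under brackets with basis vectors is
    stable under every e^{ij}, and these span so(n+1). *)
Lemma irreducible_representationP : (2 < n)%N -> lie_irreducible rho ->
  irreducible_representation rho <->
  forall a b c d m, pfaffian rho a b c d m = 0.
Proof.
move=> n_gt2 [M_neq0 M_irr]; split=> [[_ [br [brP _]]]|pf0].
  exact: induced_bracket_pfaffian brP.
split=> //; exists (module_bracket rho); split; first exact: module_bracket_induced.
split=> // W [Wsub WP]; apply: (M_irr W Wsub) => x m Wm.
have [W0 Wlin] := Wsub.
have WD u v : W u -> W v -> W (u + v) by move=> Wu Wv; rewrite -[u]scale1r; exact: Wlin.
have WZ k u : W u -> W (k *: u) by move=> Wu; rewrite -[_ *: _]addr0; exact: Wlin.
have n_gt0 : (n.-1 < n)%N by rewrite prednK // (ltn_trans _ n_gt2).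
have [_ indP] := module_bracket_induced rhoP pf0.
have Wunit (i j : 'I_n.+1) : (i < j)%N -> W (rho (so_unit K i j) m).
  move=> ij; have i_n : (i < n)%N by rewrite (leq_trans ij) // -ltnS.
  have := WP (Ordinal n_gt0) [ffun k => delta_mx 0 (lift j (lift (Ordinal i_n) k))] m Wm.
  rewrite indP //= wedge_basis //.
  by rewrite (_ : widen_ord _ _ = i) //; apply/val_inj.
rewrite (so_decomposition x) (rho_suml rhoP); apply: (big_ind W) => // i _.
rewrite (rho_suml rhoP); apply: (big_ind W) => // j _; rewrite (rhoZl rhoP); apply: (WZ).
case: (ltngtP i j) => [ij|ji|/val_inj->].
- by rewrite -so_unit_bivector; exact: Wunit.
- rewrite bivectorC (rhoNl rhoP) -scaleN1r -so_unit_bivector; exact/WZ/Wunit.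
- rewrite (_ : rho _ m = 0) //; apply: self_opp_eq0; exact: rhob_skew.
Qed.

End Necessity.

(** * Highest weight vectors *)

Section IsotropicBasis.
Variables (K : numClosedFieldType) (n N : nat) (nE : n.+1 = N.*2).
Local Notation V := 'rV[K]_n.+1.
Local Notation e k := (delta_mx 0 (inord k) : V).
Local Notation eps := (@eps K n N).
Implicit Types (i j : 'I_N) (s t : bool) (p q : 'I_N * bool).

(* Weight vectors of the natural module: iso (j, true) has weight eps_j and
   iso (j, false) has weight - eps_j. *)
Definition iso p : V :=
  e p.1.*2 + (if p.2 then - 'i else 'i) *: e p.1.*2.+1.

Definition dual p := (p.1, ~~ p.2).
Definition pm s : K := if s then 1 else -1.
Definition wt p j : K := if p.1 == j then pm p.2 else 0.

Lemma dualK : involutive dual. Proof. by move=> [i s]; rewrite /dual /= negbK. Qed.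

Lemma double_lt j : (j.*2.+1 < n.+1)%N.
Proof. by rewrite nE -doubleS leq_double ltn_ord. Qed.

Lemma inord_dot k l : (k < n.+1)%N -> (l < n.+1)%N -> dot (e k) (e l) = (k == l)%:R.
Proof. by move=> kn ln; rewrite dot_delta -val_eqE /= !inordK. Qed.

Lemma dot_iso p q : dot (iso p) (iso q) = (if p == dual q then 2 else 0).
Proof.
case: p q => [i s] [j t]; rewrite /iso /dual /=.
rewrite dotDl !dotDr !dotZl !dotZr !inord_dot ?double_lt ?(ltnW (double_lt _)) //.
rewrite eqSS (inj_eq double_inj).
have odd_even k l : (k.*2 == l.*2.+1) = false.
  by apply/eqP => /(congr1 odd); rewrite /= !odd_double.
rewrite odd_even (eq_sym _.+1) odd_even -pair_eqE /= -val_eqE /=.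
have ii : 'i * 'i = -1 :> K by rewrite -expr2 sqrCi.
case: (_ == _); last by rewrite !mulr0 !addr0.
by rewrite !mulr0 add0r addr0; case: s; case: t; rewrite /= mulr1 ?mulrN ?mulNr ii; ring.
Qed.

Lemma bivector_iso j : bivector (iso (j, true)) (iso (j, false)) = 2 *: eps j.
Proof.
rewrite /iso /Defs.eps so_unit_bivector /=.
move: (e _) (e _) => a b; apply: so_ext => k l.
by rewrite !so_valZ !bivectorE !mxE; ring.
Qed.

Lemma iso_span (a : V) : exists c : 'I_N * bool -> K, a = \sum_p c p *: iso p.
Proof.
pose spanned u := exists c : 'I_N * bool -> K, u = \sum_p c p *: iso p.
have span0 : spanned 0.
  by exists (fun=> 0); rewrite big1 // => p _; rewrite scale0r.
have spanD u v : spanned u -> spanned v -> spanned (u + v).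
  move=> [c ->] [d ->]; exists (fun p => c p + d p); rewrite -big_split.
  by apply: eq_bigr => p _ /=; rewrite scalerDl.
have spanZ k u : spanned u -> spanned (k *: u).
  move=> [c ->]; exists (fun p => k * c p); rewrite scaler_sumr.
  by apply: eq_bigr => p _ /=; rewrite scalerA.
have span_iso p : spanned (iso p).
  exists (fun q => (q == p)%:R); rewrite (bigD1 p) //= eqxx scale1r big1 ?addr0 //.
  by move=> q /negbTE ->; rewrite scale0r.
have ii : 'i * 'i = -1 :> K by rewrite -expr2 sqrCi.
rewrite [a]row_sum_delta; apply: (big_ind spanned) => // k _; apply: (spanZ).
have kN : (k./2 < N)%N by rewrite -ltn_double -nE (leq_ltn_trans _ (ltn_ord k)) //
  -[leqRHS]odd_double_half leq_addl.
pose j := Ordinal kN; have -> : k = inord (odd k + j.*2) :> 'I_n.+1.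
  by rewrite odd_double_half inord_val.
case: (odd k); rewrite /= ?add1n ?add0n.
  have -> : e j.*2.+1 = ('i / 2) *: (iso (j, true) + (-1) *: iso (j, false)).
    rewrite /iso /=; move: (e j.*2) (e j.*2.+1) => u v.
    apply/rowP=> l; rewrite !mxE; move: (u 0 l) (v 0 l) => x y.
    transitivity (- ('i * 'i) * y); first by rewrite ii; ring.
    by field.
  by apply/spanZ/spanD; [|apply: (spanZ)]; exact: span_iso.
have -> : e j.*2 = 2^-1 *: (iso (j, true) + iso (j, false)).
  rewrite /iso /=; move: (e j.*2) (e j.*2.+1) => u v.
  by apply/rowP=> l; rewrite !mxE; field.
by apply/spanZ/spanD; exact: span_iso.
Qed.

Variables (M : lmodType K) (rho : so K n.+1 -> M -> M).
Hypothesis rhoP : lie_module (@so_bracket K n.+1) rho.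
Implicit Types z : M.

Lemma rho_eps j z : rho (eps j) z = 2^-1 *: rhob rho (iso (j, true)) (iso (j, false)) z.
Proof.
rewrite /rhob bivector_iso [rho (2 *: _) z](rhoZl rhoP) scalerA.
by rewrite mulVf ?scale1r // pnatr_eq0.
Qed.

Lemma natural_act_eps j p :
  natural_act (iso (j, true)) (iso (j, false)) (iso p) = (2 * wt p j) *: iso p.
Proof.
case: p => i s; rewrite /natural_act !dot_iso /dual /= -!pair_eqE /= /wt /= eq_sym.
case: eqVneq => [->|_]; last by rewrite mulr0 !scale0r subr0.
case: s; rewrite /= ?scale0r ?subr0 ?sub0r ?mulr1 // mulrN1 scaleNr //.
Qed.

Lemma rho_eps_bivector j p q z : rho (eps j) (rhob rho (iso p) (iso q) z) =
  rhob rho (iso p) (iso q) (rho (eps j) z) + (wt p j + wt q j) *: rhob rho (iso p) (iso q) z.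
Proof.
rewrite !rho_eps (rhob_natural rhoP) !natural_act_eps (rhobZl rhoP) (rhobZr rhoP).
rewrite (rhobZv rhoP) -addrA -scalerDl scalerDr scalerA; congr (_ + _ *: _).
by field.
Qed.

Lemma rho_eps_pfaffian j p1 p2 p3 p4 z :
  rho (eps j) (pfaffian rho (iso p1) (iso p2) (iso p3) (iso p4) z) =
  pfaffian rho (iso p1) (iso p2) (iso p3) (iso p4) (rho (eps j) z) +
  (wt p1 j + wt p2 j + wt p3 j + wt p4 j) *:
    pfaffian rho (iso p1) (iso p2) (iso p3) (iso p4) z.
Proof.
rewrite !rho_eps (pfaffian_natural rhoP) !natural_act_eps.
rewrite (pfaffianZ1 rhoP) (pfaffianZ2 rhoP) (pfaffianZ3 rhoP) (pfaffianZ4 rhoP) (pfaffianZv rhoP) -!scalerDl scalerDr scalerA.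
by congr (_ + _ *: _); field.
Qed.

(** Up to a scalar, the bivector of two isotropic basis vectors is 0, some eps_j, or one with
    strictly increasing indices. *)
Lemma iso_pair_ind (P : M -> Prop) z :
  P 0 -> (forall k u, P u -> P (k *: u)) ->
  (forall j, P (rho (eps j) z)) ->
  (forall i j s t, (i < j)%N -> P (rhob rho (iso (i, s)) (iso (j, t)) z)) ->
  forall p q, P (rhob rho (iso p) (iso q) z).
Proof.
move=> P0 PZ Peps Proot [i s] [j t].
have [ij|ji|/val_inj <-] := ltngtP i j; first exact: Proot.
  by rewrite (rhob_skew rhoP) -scaleN1r; apply/PZ/Proot.
have two z' : 2^-1 *: (2 *: z') = z' by rewrite scalerA mulVf ?scale1r // pnatr_eq0.
have Pii : P (rhob rho (iso (i, true)) (iso (i, false)) z).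
  by rewrite /rhob bivector_iso (rhoZl rhoP); exact/PZ/Peps.
have self a : rhob rho a a z = 0 by apply: self_opp_eq0; exact: (rhob_skew rhoP).
case: s; case: t; rewrite ?self //.
by rewrite (rhob_skew rhoP) -scaleN1r; exact: PZ.
Qed.

Lemma iso_submodule (P : M -> Prop) : subspace P ->
  (forall p q z, P z -> P (rhob rho (iso p) (iso q) z)) ->
  forall x z, P z -> P (rho x z).
Proof.
move=> [P0 Plin] Piso x z Pz.
have PD u v : P u -> P v -> P (u + v) by move=> Pu Pv; rewrite -[u]scale1r; exact: Plin.
have PZ k u : P u -> P (k *: u) by move=> Pu; rewrite -[_ *: _]addr0; exact: Plin.
have Pb a b : P (rhob rho a b z).
  have [c ->] := iso_span a; have [d ->] := iso_span b.
  apply: (big_ind (fun a => P (rhob rho a _ z))) => [|u v Pu Pv|p _].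
  - by rewrite -(scale0r 0) (rhobZl rhoP) scale0r.
  - by rewrite (rhobDl rhoP); exact: PD.
  rewrite (rhobZl rhoP); apply: (PZ).
  apply: (big_ind (fun b => P (rhob rho _ b z))) => [|u v Pu Pv|q _].
  - by rewrite -(scale0r 0) (rhobZr rhoP) scale0r.
  - by rewrite (rhobDr rhoP); exact: PD.
  by rewrite (rhobZr rhoP); apply: (PZ); exact: Piso.
rewrite (so_decomposition x) (rho_suml rhoP); apply: (big_ind P) => // i _.
rewrite (rho_suml rhoP); apply: (big_ind P) => // j _.
by rewrite (rhoZl rhoP); apply: (PZ); exact: Pb.
Qed.

End IsotropicBasis.

(** * Singular vectors and their weights *)

Section HighestWeightVectors.
Variables (K : numClosedFieldType) (n N : nat) (nE : n.+1 = N.*2).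
Variables (M : lmodType K) (rho : so K n.+1 -> M -> M).
Hypothesis rhoP : lie_module (@so_bracket K n.+1) rho.
Local Notation eps := (@eps K n N).
Local Notation iso := (@iso K n N).
Implicit Types (i j : 'I_N) (s t : bool) (p q : 'I_N * bool) (z w : M).
Implicit Types (mu nu : 'I_N -> K).

Definition weight_vector mu z := forall j, rho (eps j) z = mu j *: z.

Definition singular z := forall i j s, (i < j)%N ->
  rhob rho (iso (i, true)) (iso (j, s)) z = 0.

(** The space U(n^-) w, given by closure under the negative root vectors, which have weights - eps_i
    + eps_j and - eps_i - eps_j for i < j. *)
Inductive lowered w : M -> Prop :=
| lowered_gen : lowered w w
| lowered0 : lowered w 0
| lowered_linear k u z of lowered w u & lowered w z : lowered w (k *: u + z)
| lowered_down i j s z of (i < j)%N & lowered w z :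
    lowered w (rhob rho (iso (i, false)) (iso (j, s)) z).

Lemma loweredZ w k z : lowered w z -> lowered w (k *: z).
Proof. by move=> wz; rewrite -[_ *: _]addr0; apply: lowered_linear => //; exact: lowered0. Qed.

Lemma loweredD w u z : lowered w u -> lowered w z -> lowered w (u + z).
Proof. by move=> wu wz; rewrite -[u]scale1r; exact: lowered_linear. Qed.

(* A raising or Cartan operator is commuted to the right past the lowering ones. *)
Lemma lowered_submodule w mu : singular w -> weight_vector mu w ->
  forall x z, lowered w z -> lowered w (rho x z).
Proof.
move=> w_sing w_wt; apply: (iso_submodule nE rhoP) => [|p q z wz].
  by split=> [|k u z]; [exact: lowered0 | exact: lowered_linear].
elim: wz p q => {z} [||k u z _ IHu _ IHz|i j s z ij wz IHz] p q.
- apply: (iso_pair_ind rhoP) => [|k u|j|i j [] t ij].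
  + exact: lowered0.
  + exact: loweredZ.
  + by rewrite w_wt; apply/loweredZ/lowered_gen.
  + by rewrite w_sing //; exact: lowered0.
  + by apply: lowered_down => //; exact: lowered_gen.
- by rewrite (rhob0v rhoP); exact: lowered0.
- by rewrite (rhobDv rhoP) (rhobZv rhoP); apply: lowered_linear.
rewrite (rhob_comm rhoP); apply: loweredD; first exact: lowered_down.
by rewrite -!scaleNr; do !apply: loweredD; apply: loweredZ.
Qed.

(** The action of eps_1 + .. + eps_k. Every negative root takes one of the values 0, -1, -2 on this
    element, and all k together determine a weight. *)
Definition partial_cartan (k : nat) z := \sum_(j < N | (j < k)%N) rho (eps j) z.
Definition partial_weight (k : nat) mu := \sum_(j < N | (j < k)%N) mu j.

Lemma partial_cartan_bivector k p q z :
  partial_cartan k (rhob rho (iso p) (iso q) z) =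
  rhob rho (iso p) (iso q) (partial_cartan k z) +
  (partial_weight k (wt K p) + partial_weight k (wt K q)) *: rhob rho (iso p) (iso q) z.
Proof.
rewrite /partial_cartan [rhob _ _ _ (\sum_(_ < _ | _) _)](rho_sumr rhoP).
rewrite -big_split scaler_suml -big_split.
by apply: eq_bigr => j _; exact: (rho_eps_bivector nE).
Qed.

Lemma partial_cartan_weight k mu z :
  weight_vector mu z -> partial_cartan k z = partial_weight k mu *: z.
Proof.
by move=> zmu; rewrite scaler_suml; apply: eq_bigr => j _; rewrite zmu.
Qed.

Lemma partial_weight_lowering k i j s : (i < j)%N -> exists m : nat,
  partial_weight k (wt K (i, false)) + partial_weight k (wt K (j, s)) = - m%:R.
Proof.
have wtE p : partial_weight k (wt K p) = if (p.1 < k)%N then pm K p.2 else 0.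
  rewrite /partial_weight big_mkcond (bigD1 p.1) //= /wt eqxx big1 ?addr0 // => l.
  by rewrite eq_sym => /negbTE ->; case: ifP.
move=> ij; rewrite !wtE /=; case: (ltnP j k) => [jk|_].
  rewrite (ltn_trans ij jk); case: s => /=.
    by exists 0%N; rewrite addrC subrr oppr0.
  by exists 2; rewrite -opprD.
by exists (i < k)%N; rewrite addr0; case: ifP; rewrite ?oppr0.
Qed.

Definition shift_cartan k (c : K) z := partial_cartan k z - c *: z.

Lemma shift_cartanD k c : {morph shift_cartan k c : u z / u + z}.
Proof.
move=> u z; rewrite /shift_cartan /partial_cartan.
rewrite (eq_bigr (fun j => rho (eps j) u + rho (eps j) z)) ?big_split /=.
  by module.
by move=> j _; rewrite (rhoDr rhoP).
Qed.

Lemma shift_cartanZ k c a z : shift_cartan k c (a *: z) = a *: shift_cartan k c z.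
Proof.
rewrite /shift_cartan /partial_cartan scalerBr scaler_sumr scalerA mulrC -scalerA.
by congr (_ - _); apply: eq_bigr => j _; rewrite (rhoZr rhoP).
Qed.

Lemma shift_cartan0 k c : shift_cartan k c 0 = 0.
Proof. by rewrite -[X in shift_cartan _ _ X](scale0r (0 : M)) shift_cartanZ scale0r. Qed.

Lemma shift_cartanC k a b z :
  shift_cartan k a (shift_cartan k b z) = shift_cartan k b (shift_cartan k a z).
Proof.
have E c u : shift_cartan k c u = shift_cartan k 0 u - c *: u.
  by rewrite /shift_cartan scale0r subr0.
rewrite [LHS]E [RHS]E (E b z) (E a z) -!scaleNr !shift_cartanD !shift_cartanZ.
by module.
Qed.

Definition shift_seq k c (ds : seq nat) z :=
  foldr (fun d => shift_cartan k (c - d%:R)) z ds.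

Lemma shift_seqD k c ds : {morph shift_seq k c ds : u z / u + z}.
Proof. by move=> u z; elim: ds => //= d ds ->; rewrite shift_cartanD. Qed.

Lemma shift_seqZ k c ds a z : shift_seq k c ds (a *: z) = a *: shift_seq k c ds z.
Proof. by elim: ds => //= d ds ->; rewrite shift_cartanZ. Qed.

Lemma shift_seq0 k c ds : shift_seq k c ds 0 = 0.
Proof. by elim: ds => //= d ds ->; rewrite shift_cartan0. Qed.

Lemma shift_seqC k c ds1 ds2 z :
  shift_seq k c ds1 (shift_seq k c ds2 z) = shift_seq k c ds2 (shift_seq k c ds1 z).
Proof.
elim: ds1 => //= d ds1 ->; elim: ds2 => //= d2 ds2 <-.
by rewrite shift_cartanC.
Qed.

(** Instead of decomposing [z] into weight vectors, a product of factors H - (c - d), d a natural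
    number, is found that kills it. The factors commute, so a sum is killed by the concatenated
    list; a lowering operator shifts every [d] by the drop [m] of its weight. *)
Lemma lowered_annihilated k w mu z : weight_vector mu w -> lowered w z ->
  exists ds, shift_seq k (partial_weight k mu) ds z = 0.
Proof.
move=> w_wt; elim=> {z} [||a u z _ [ds1 u0] _ [ds2 z0]|i j s z ij _ [ds z0]].
- exists [:: 0%N]; rewrite /= /shift_cartan (partial_cartan_weight _ w_wt) subr0.
  exact: subrr.
- by exists [::].
- exists (ds1 ++ ds2); rewrite /shift_seq foldr_cat -!/(shift_seq _ _ _ _).
  rewrite !shift_seqD !shift_seqZ z0 shift_seqC u0.
  by rewrite shift_seq0 scaler0 add0r shift_seq0.
have [m mE] := partial_weight_lowering k s ij.
exists (map (addn m) ds); set D := rhob rho _ _.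
suff -> : shift_seq k (partial_weight k mu) (map (addn m) ds) (D z) =
    D (shift_seq k (partial_weight k mu) ds z) by rewrite z0 /D (rhob0v rhoP).
elim: ds {z0} => //= d ds ->; set u := shift_seq _ _ _ _.
rewrite /shift_cartan /D partial_cartan_bivector mE -!scaleNr (rhobDv rhoP) (rhobZv rhoP).
rewrite natrD -addrA; congr (_ + _); rewrite -scalerDl; congr (_ *: _); ring.
Qed.

Hypothesis M_irr : lie_irreducible rho.

(** By irreducibility [z] lies in U(n^-) w. On the eigenvector [z] the annihilating product is a
    product of scalars, so one factor is zero. *)
Lemma weights_below k w mu z nu : singular w -> weight_vector mu w -> w <> 0 ->
  weight_vector nu z -> z <> 0 ->
  exists d : nat, partial_weight k nu = partial_weight k mu - d%:R.
Proof.
move=> w_sing w_wt w_neq0 z_wt z_neq0.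
have wz : lowered w z.
  have [_ irr] := M_irr.
  have sub : subspace (lowered w).
    by split=> [|a u v]; [exact: lowered0 | exact: lowered_linear].
  have [w0|//] := irr _ sub (lowered_submodule w_sing w_wt).
  by case: w_neq0; apply: w0; exact: lowered_gen.
have [ds] := lowered_annihilated k w_wt wz.
elim: ds => [/z_neq0 //|d ds IH] /=.
have shiftE c : shift_cartan k c z = (partial_weight k nu - c) *: z.
  by rewrite /shift_cartan (partial_cartan_weight _ z_wt) scalerBl.
have [->|neq] := eqVneq (partial_weight k nu) (partial_weight k mu - d%:R).
  by exists d.
rewrite -[shift_cartan _ _ _]/(shift_seq k _ [:: d] _) shift_seqC /= shiftE shift_seqZ.
move=> /eqP; rewrite scaler_eq0 => /orP[|/eqP /IH //].
by rewrite subr_eq0 (negbTE neq).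
Qed.

(** The drops in the two directions are natural numbers with sum 0, so both vanish; successive
    partial sums differ by one coordinate. *)
Lemma singular_weight w mu z nu :
  singular w -> weight_vector mu w -> w <> 0 ->
  singular z -> weight_vector nu z -> z <> 0 -> mu =1 nu.
Proof.
move=> w_sing w_wt w_neq0 z_sing z_wt z_neq0.
have partialE k : partial_weight k mu = partial_weight k nu.
  have [d dE] := weights_below k w_sing w_wt w_neq0 z_wt z_neq0.
  have [d' dE'] := weights_below k z_sing z_wt z_neq0 w_wt w_neq0.
  have /eqP : (d + d')%:R = 0 :> K.
    by rewrite natrD -(subrr (partial_weight k mu)) {2}dE' dE; ring.
  by rewrite pnatr_eq0 addn_eq0 => /andP[/eqP d0 _]; rewrite dE d0 subr0.
move=> j; have partialS nu' : partial_weight j.+1 nu' = partial_weight j nu' + nu' j.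
  rewrite /partial_weight (bigD1 j) //= addrC; congr (_ + _).
  by apply: eq_bigl => l; rewrite ltnS [RHS]ltn_neqAle andbC.
by have := partialE j.+1; rewrite !partialS partialE => /addrI.
Qed.

End HighestWeightVectors.

(** * The x_{a,b,c,d} on a highest weight vector *)

Section PfaffianHighestWeight.
Variables (K : numClosedFieldType) (n N : nat) (nE : n.+1 = N.*2).
Variables (M : lmodType K) (rho : so K n.+1 -> M -> M).
Hypothesis rhoP : lie_module (@so_bracket K n.+1) rho.
Variables (v : M) (lam : 'I_N -> K).
Hypothesis v_sing : singular N rho v.
Hypothesis v_wt : weight_vector rho lam v.
Local Notation eps := (@eps K n N).
Local Notation iso := (@iso K n N).
Local Notation pf p1 p2 p3 p4 z := (pfaffian rho (iso p1) (iso p2) (iso p3) (iso p4) z).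
Implicit Types (i j : 'I_N) (s t : bool) (p q : 'I_N * bool).

Lemma pfaffian0v a b c d : pfaffian rho a b c d 0 = 0.
Proof. by have := pfaffianZv rhoP a b c d 0 0; rewrite !scale0r. Qed.

Lemma rhob_iso_hw i : rhob rho (iso (i, true)) (iso (i, false)) v = (2 * lam i) *: v.
Proof.
have := v_wt i; rewrite (rho_eps rhoP) => E.
by rewrite -scalerA -E scalerA divff ?scale1r // pnatr_eq0.
Qed.

(** The first product gives 4 lam_i lam_j and the lower order terms - 4 lam_j. In the other two
    products the outer factor is a positive root vector and kills [v], so only commutators remain:
    they add 8 lam_j while their lam_i parts cancel. *)
Lemma pfaffian_hw i j : (i < j)%N ->
  pf (i, true) (i, false) (j, true) (j, false) v = (4 * (lam j * (lam i + 1))) *: v.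
Proof.
move=> ij; rewrite /pfaffian.
have ji : (j == i) = false by rewrite -val_eqE /= gtn_eqF.
have ij' : (i == j) = false by rewrite eq_sym.
rewrite (rhob_comm rhoP (iso (i, true)) (iso (j, true))).
rewrite (rhob_comm rhoP (iso (i, true)) (iso (j, false))).
rewrite !(v_sing _ ij).
rewrite !dot_iso // /dual /= -!pair_eqE /= ?eqxx ?ji ?ij' /=.
rewrite !rhob_iso_hw !(rhob_vE rhoP) !rhob_iso_hw (rhob_skew rhoP (iso (j, true))).
by rewrite rhob_iso_hw; module.
Qed.

(* The height of a weight vector in the natural module, shifted to be positive. *)
Definition height p : nat := (if p.2 then N.*2 - p.1 else p.1)%N.

Lemma height_le p : (height p <= N.*2)%N.
Proof. by case: p => [[i iN] []]; rewrite /height /=; lia. Qed.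

(** Each coefficient is a dot product, nonzero only if [p] is dual to one of the two vectors; [p] is
    then sent to a multiple of the other one, which is higher because i < j. *)
Lemma natural_act_raise i j s p : (i < j)%N -> exists q1 q2 (k l : K),
  [/\ natural_act (iso (i, true)) (iso (j, s)) (iso p) = k *: iso q1 - l *: iso q2,
      (height p < height q1)%N \/ k = 0 & (height p < height q2)%N \/ l = 0].
Proof.
move=> ij; exists (i, true), (j, s), (dot (iso (j, s)) (iso p)), (dot (iso (i, true)) (iso p)).
have iN := ltn_ord i; have jN := ltn_ord j.
split=> //; rewrite dot_iso //; case: p => k t; rewrite /dual -pair_eqE /=.
  case: eqP => [<-|_]; last by right.
  case: s; case: t; rewrite /= /height /=; [right|left|left|right] => //; lia.
case: eqP => [<-|_]; last by right.
case: t; rewrite /= /height /=; [by right|left].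
by case: s => /=; lia.
Qed.

(** As [v] is killed, equivariance leaves only the terms in which one of the four arguments is
    raised. *)
Lemma pfaffian_raise i j s p1 p2 p3 p4 : (i < j)%N ->
  (forall q1 q2 q3 q4,
    (height p1 + height p2 + height p3 + height p4 <
     height q1 + height q2 + height q3 + height q4)%N -> pf q1 q2 q3 q4 v = 0) ->
  rhob rho (iso (i, true)) (iso (j, s)) (pf p1 p2 p3 p4 v) = 0.
Proof.
move=> ij pf0; rewrite (pfaffian_natural rhoP) v_sing // pfaffian0v.
have raise p := @natural_act_raise i j s p ij.
rewrite add0r; have [q1 [q1' [k1 [l1 [-> q1h q1'h]]]]] := raise p1.
have [q2 [q2' [k2 [l2 [-> q2h q2'h]]]]] := raise p2.
have [q3 [q3' [k3 [l3 [-> q3h q3'h]]]]] := raise p3.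
have [q4 [q4' [k4 [l4 [-> q4h q4'h]]]]] := raise p4.
rewrite (pfaffianB1 rhoP) (pfaffianB2 rhoP) (pfaffianB3 rhoP) (pfaffianB4 rhoP).
have zero (h h' : nat) (k : K) z : (h < h')%N \/ k = 0 -> ((h < h')%N -> z = 0 :> M) ->
    k *: z = 0.
  by move=> [hh /(_ hh) ->|-> _]; rewrite ?scaler0 ?scale0r.
rewrite (zero _ _ _ _ q1h) 1?(zero _ _ _ _ q1'h) 1?(zero _ _ _ _ q2h) //
  1?(zero _ _ _ _ q2'h) 1?(zero _ _ _ _ q3h) 1?(zero _ _ _ _ q3'h) //
  1?(zero _ _ _ _ q4h) 1?(zero _ _ _ _ q4'h) ?subr0 ?addr0 // => hh;
  apply: pf0; rewrite ?ltn_add2r ?ltn_add2l //; lia.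
Qed.

Lemma pfaffian_weight p1 p2 p3 p4 : weight_vector rho
  (fun j => lam j + (wt K p1 j + wt K p2 j + wt K p3 j + wt K p4 j)) (pf p1 p2 p3 p4 v).
Proof.
move=> j; rewrite (rho_eps_pfaffian nE rhoP) v_wt (pfaffianZv rhoP).
by rewrite -scalerDl.
Qed.

Hypothesis lamP : forall i j, (i < j)%N -> lam j * (lam i + 1) = 0.

Lemma pfaffian_dual_pairs p q : pf p (dual p) q (dual q) v = 0.
Proof.
wlog ps : p / p.2.
  move=> H; case ps: p.2; first exact: H.
  by rewrite (pfaffian_swap12 rhoP) -{2}(dualK p) H ?oppr0 //= ps.
wlog qs : q / q.2.
  move=> H; case qs: q.2; first exact: H.
  by rewrite (pfaffian_swap34 rhoP) -{2}(dualK q) H ?oppr0 //= qs.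
case: p q ps qs => [i []] // [j []] // _ _; rewrite /dual /=.
have [ij|ji|/val_inj <-] := ltngtP i j; last exact: (pfaffian13 rhoP).
  by rewrite pfaffian_hw // lamP // mulr0 scale0r.
rewrite (pfaffian_swap23 rhoP) (pfaffian_swap12 rhoP) (pfaffian_swap34 rhoP).
by rewrite (pfaffian_swap23 rhoP) pfaffian_hw // lamP // mulr0 scale0r !oppr0.
Qed.

Lemma pfaffian_dual12 p q r :
  (forall j, wt K q j + wt K r j = 0) -> pf p (dual p) q r v = 0.
Proof.
case: q r => [i s] [j t] /(_ i); rewrite /wt /= eqxx.
have two : (1 + 1 : K) != 0 by rewrite -[1 + 1]/(2%:R) pnatr_eq0.
case: (eqVneq j i) => [->|_]; last first.
  by move=> /eqP; rewrite addr0; case: s; rewrite ?oppr_eq0 oner_eq0.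
move=> wt0; rewrite (_ : t = ~~ s); first exact: (pfaffian_dual_pairs p (i, s)).
move: wt0; case: s; case: t => //= /eqP; last by rewrite -opprD oppr_eq0 (negbTE two).
by rewrite (negbTE two).
Qed.

(** If no other argument were dual to [p1], every nonzero contribution to the coordinate of [p1]
    would have the same sign and the sum could not vanish. Removing a dual pair leaves two arguments
    of opposite weights, again a dual pair. *)
Lemma pfaffian_weight0 p1 p2 p3 p4 :
  (forall j, wt K p1 j + wt K p2 j + wt K p3 j + wt K p4 j = 0) -> pf p1 p2 p3 p4 v = 0.
Proof.
move=> wt0; have wt_dual j : wt K (dual p1) j = - wt K p1 j.
  by rewrite /wt /=; case: eqP => _; rewrite ?oppr0 //; case: p1.2; rewrite /= ?opprK.
have [E|p2N] := eqVneq p2 (dual p1).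
  rewrite E pfaffian_dual12 // => j; have := wt0 j; rewrite E wt_dual.
  by rewrite subrr add0r.
have [E|p3N] := eqVneq p3 (dual p1).
  rewrite E (pfaffian_swap23 rhoP) pfaffian_dual12 ?oppr0 // => j.
  by have := wt0 j; rewrite E wt_dual => <-; ring.
have [E|p4N] := eqVneq p4 (dual p1).
  rewrite E (pfaffian_swap34 rhoP) (pfaffian_swap23 rhoP) pfaffian_dual12 ?oppr0 // => j.
  by have := wt0 j; rewrite E wt_dual => <-; ring.
have wtE p : p != dual p1 -> exists m : nat, wt K p p1.1 = pm K p1.2 * m%:R.
  case: p p1 {wt0 wt_dual p2N p3N p4N} => [i s] [j t]; rewrite /dual /wt -pair_eqE /=.
  have [_|_ _] := eqVneq i j; last by exists 0%N; rewrite mulr0.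
  by case: s; case: t => //= _; exists 1%N; rewrite mulr1.
have [m2 E2] := wtE _ p2N; have [m3 E3] := wtE _ p3N; have [m4 E4] := wtE _ p4N.
have /eqP := wt0 p1.1; rewrite E2 E3 E4 {1}/wt eqxx.
have -> : pm K p1.2 + pm K p1.2 * m2%:R + pm K p1.2 * m3%:R + pm K p1.2 * m4%:R =
    pm K p1.2 * (1 + m2 + m3 + m4)%:R by rewrite !natrD; ring.
rewrite mulf_eq0 pnatr_eq0 /=; case: p1.2; rewrite /= ?oppr_eq0 oner_eq0 //.
Qed.

Hypothesis M_irr : lie_irreducible rho.
Hypothesis v_neq0 : v <> 0.

Lemma pfaffian_iso_hw p1 p2 p3 p4 : pf p1 p2 p3 p4 v = 0.
Proof.
(* Descending induction on the total height, at most four times [N.*2]. *)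
have [m] := ubnP (N.*2 * 4 - (height p1 + height p2 + height p3 + height p4)).
elim: m => // m IH in p1 p2 p3 p4 * => hm.
have [//|/eqP w_neq0] := eqVneq (pf p1 p2 p3 p4 v) 0.
(* A nonzero value is singular by induction, hence has weight [lam]; so the weights of the four
   arguments add up to zero. *)
apply: pfaffian_weight0 => j; apply: (addrI (lam j)); rewrite addr0.
have w_sing : singular N rho (pf p1 p2 p3 p4 v).
  move=> i k s ik; apply: pfaffian_raise => // q1 q2 q3 q4 hq; apply: IH.
  have := height_le q1; have := height_le q2; have := height_le q3; have := height_le q4.
  lia.
symmetry.
exact: (singular_weight nE rhoP M_irr v_sing v_wt v_neq0 w_sing (@pfaffian_weight _ _ _ _)).
Qed.

(** The vectors killed by all pfaffians form a submodule, by [pfaffian_natural], and this submodule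
    contains [v]. *)
Lemma pfaffian_eq0 a b c d z : pfaffian rho a b c d z = 0.
Proof.
have [_ irr] := M_irr.
pose P z := forall a b c d, pfaffian rho a b c d z = 0.
have [||v0|all0] := irr P; last exact: all0.
- split=> [|k u w u0 w0] a' b' c' d'.
    exact: pfaffian0v.
  by rewrite (pfaffianDv rhoP) (pfaffianZv rhoP) u0 w0 scaler0 addr0.
- apply: (iso_submodule nE rhoP) => [|p q u u0 a' b' c' d'].
    split=> [|k u w u0 w0] a' b' c' d'.
      exact: pfaffian0v.
    by rewrite (pfaffianDv rhoP) (pfaffianZv rhoP) u0 w0 scaler0 addr0.
  have := pfaffian_natural rhoP (iso p) (iso q) a' b' c' d' u.
  by rewrite !u0 (rhob0v rhoP) !addr0.
- case: v_neq0; apply: v0 => a' b' c' d'.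
  by apply: (pfaffian_span rhoP (iso_span nE)) => *; exact: pfaffian_iso_hw.
Qed.

End PfaffianHighestWeight.

(** * Roots and weights of so(2N) *)

Section RootSystem.
Variables (K : numClosedFieldType) (n N : nat) (nE : n.+1 = N.*2).
Local Notation eps := (@eps K n N).
Local Notation iso := (@iso K n N).
Local Notation cartan := (@cartan K n N).
Local Notation weight_form := (@weight_form K n N).
Implicit Types (i j : 'I_N) (s t : bool) (lam mu h : 'rV[K]_N).

Lemma half_double (W : lmodType K) (x : W) : 2^-1 *: (2 *: x) = x.
Proof. by rewrite scalerA mulVf ?scale1r // pnatr_eq0. Qed.

Lemma so_bracket_linear_l k (x y z : so K n.+1) :
  so_bracket (k *: x + y) z = k *: so_bracket x z + so_bracket y z.
Proof.
apply: so_ext => a b; rewrite so_valD so_valZ !so_val_bracket.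
have mulE (u w : so K n.+1) : (so_val u *m so_val w) a b =
    \sum_c so_val u a c * so_val w c b by rewrite mxE.
rewrite !mulE.
rewrite mulrBr !mulr_sumr addrACA -opprD -!big_split /=.
by congr (_ - _); apply: eq_bigr => c _; rewrite !mxE; ring.
Qed.

Lemma so_formE (x y : so K n.+1) :
  so_form x y = 2^-1 * \sum_a \sum_b so_val x a b * so_val y b a.
Proof. by congr (_ * _); apply: eq_bigr => a _; rewrite mxE. Qed.

Lemma so_form_linear_l k (x y z : so K n.+1) :
  so_form (k *: x + y) z = k * so_form x z + so_form y z.
Proof.
rewrite !so_formE [k * _]mulrCA -[RHS]mulrDr; congr (_ * _).
rewrite mulr_sumr -big_split; apply: eq_bigr => a _ /=.
rewrite mulr_sumr -big_split; apply: eq_bigr => b _ /=.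
by rewrite !mxE; ring.
Qed.

Lemma so_form0l (x : so K n.+1) : so_form (0 : so K n.+1) x = 0.
Proof.
by have := so_form_linear_l (-1) 0 0 x; rewrite scaleN1r oppr0 addr0 mulN1r addNr.
Qed.

Lemma so_bracket0l (x : so K n.+1) : so_bracket 0 x = 0.
Proof.
by have := so_bracket_linear_l (-1) 0 0 x; rewrite scaleN1r oppr0 addr0 scaleN1r addNr.
Qed.

Lemma so_formC (x y : so K n.+1) : so_form x y = so_form y x.
Proof. by rewrite /so_form mxtrace_mulC. Qed.

Lemma so_form_bivector (a b c d : 'rV[K]_n.+1) :
  so_form (bivector a b) (bivector c d) = dot a d * dot b c - dot a c * dot b d.
Proof.
rewrite /so_form /mxtrace.
rewrite (eq_bigr (fun k => a 0 k * d 0 k * dot b c - a 0 k * c 0 k * dot b d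
  - b 0 k * d 0 k * dot a c + b 0 k * c 0 k * dot a d)); last first.
  by move=> k _; rewrite bivector_mulmx.
rewrite big_split !sumrB /= -!mulr_suml -/(dot a d) -/(dot a c) -/(dot b d) -/(dot b c).
by field.
Qed.

Lemma so_form_eps i j : so_form (eps i) (eps j) = (i == j)%:R.
Proof.
have epsE k : eps k = 2^-1 *: bivector (iso (k, true)) (iso (k, false)) + 0.
  by rewrite bivector_iso half_double addr0.
rewrite (epsE i) so_form_linear_l so_form0l addr0 so_formC (epsE j) so_form_linear_l so_form0l addr0.
rewrite so_form_bivector !dot_iso // /dual -!pair_eqE /= !andbT !andbF [j == i]eq_sym.
by case: (i == j); rewrite /= ?eqxx; field.
Qed.

Lemma weight_formE lam h : weight_form lam h = \sum_j lam 0 j * h 0 j.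
Proof.
have formE mu x : so_form (cartan mu) x = \sum_j mu 0 j * so_form (eps j) x.
  apply: (big_rec2 (fun y r => so_form y x = r)) => [|j y r _ <-].
    exact: so_form0l.
  exact: so_form_linear_l.
rewrite /Defs.weight_form formE; apply: eq_bigr => i _; congr (_ * _).
rewrite so_formC formE (bigD1 i) //= so_form_eps eqxx mulr1 big1 ?addr0 // => j ji.
by rewrite so_form_eps (negbTE ji) mulr0.
Qed.

Lemma cartan_delta j : cartan (delta_mx 0 j) = eps j.
Proof.
rewrite /Defs.cartan (bigD1 j) //= mxE !eqxx scale1r big1 ?addr0 // => i ij.
by rewrite mxE (negbTE ij) andbF scale0r.
Qed.

Lemma so_bracket_eps j (p q : 'I_N * bool) :
  so_bracket (eps j) (bivector (iso p) (iso q)) =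
  (wt K p j + wt K q j) *: bivector (iso p) (iso q).
Proof.
have epsE : eps j = 2^-1 *: bivector (iso (j, true)) (iso (j, false)) + 0.
  by rewrite bivector_iso half_double addr0.
have natE (a b c d : 'rV[K]_n.+1) : so_bracket (bivector a b) (bivector c d) =
    bivector (natural_act a b c) d + bivector c (natural_act a b d).
  rewrite so_bracket_bivector /natural_act (bivectorC (_ - _) c) -!scaleNr.
  rewrite !bivectorDl !bivectorZl (bivectorC c a) (bivectorC c b); module.
rewrite epsE so_bracket_linear_l so_bracket0l addr0 natE !(natural_act_eps K nE).
rewrite (bivectorC (_ *: _)) !bivectorZl (bivectorC (iso p) (iso q)) scalerN opprK -scalerDl.
by rewrite scalerA; congr (_ *: _); field.
Qed.

Definition so_root i j s : 'rV[K]_N := \row_k (wt K (i, true) k + wt K (j, s) k).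

Lemma root_vector_iso i j s : root_vector (so_root i j s) (bivector (iso (i, true)) (iso (j, s))).
Proof.
move=> h; rewrite weight_formE.
rewrite scaler_suml; set x := bivector _ _.
apply: (big_rec2 (fun y z => so_bracket y x = z)) => [|k y z _ <-]; first exact: so_bracket0l.
by rewrite so_bracket_linear_l so_bracket_eps scalerA mxE mulrC.
Qed.

Definition nat_span (alpha : 'rV[K]_N) :=
  exists c : 'I_N -> nat, alpha = \sum_(i < N) (c i)%:R *: simple_root K i.

Lemma nat_spanD alpha beta : nat_span alpha -> nat_span beta -> nat_span (alpha + beta).
Proof.
move=> [c ->] [d ->]; exists (fun i => c i + d i)%N; rewrite -big_split.
by apply: eq_bigr => i _; rewrite natrD scalerDl.
Qed.

Lemma nat_span_simple i : nat_span (simple_root K i).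
Proof.
exists (fun j => (j == i) : nat); rewrite (bigD1 i) //= eqxx scale1r big1 ?addr0 //.
by move=> j /negbTE ->; rewrite scale0r.
Qed.

Lemma nat_span0 : nat_span 0.
Proof. by exists (fun=> 0%N); rewrite big1 // => i _; rewrite scale0r. Qed.

Let ek (k : nat) : 'rV[K]_N := \row_j (j == k :> nat)%:R.

Lemma nat_span_sub (k l : nat) : (k <= l)%N -> (l < N)%N -> nat_span (ek k - ek l).
Proof.
elim: l => [|l IH]; rewrite leq_eqVlt => /predU1P[-> _|//];
  try by rewrite subrr; exact: nat_span0.
rewrite ltnS => kl lN.
have -> : ek k - ek l.+1 = (ek k - ek l) + (ek l - ek l.+1) by rewrite addrA subrK.
apply: nat_spanD; first by apply: IH => //; exact: ltnW.
have := nat_span_simple (Ordinal (ltnW lN)); rewrite /simple_root /= lN.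
rewrite (_ : \row_j _ = ek l - ek l.+1) //.
by apply/rowP => j; rewrite !mxE.
Qed.

(** Both summands are telescoped down to the last two coordinates, whose sum is the last simple
    root. *)
Lemma nat_span_add (k l : nat) : (k < l)%N -> (l < N)%N -> nat_span (ek k + ek l).
Proof.
move=> kl lN; have N_gt0 : (N.-1 < N)%N by rewrite prednK // (leq_ltn_trans _ lN).
have -> : ek k + ek l = (ek k - ek N.-2) + ((ek l - ek N.-1) + (ek N.-2 + ek N.-1)).
  by module.
apply: nat_spanD; first by apply: nat_span_sub; lia.
apply: nat_spanD; first by apply: nat_span_sub; lia.
have := nat_span_simple (Ordinal N_gt0); rewrite /simple_root /=.
rewrite (_ : (N.-1.+1 < N)%N = false); last by lia.
rewrite (_ : \row_j _ = ek N.-2 + ek N.-1) //.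
by apply/rowP => j; rewrite !mxE.
Qed.

Lemma positive_root_iso i j s : (i < j)%N -> positive_root n (so_root i j s).
Proof.
move=> ij; have ji : (j == i) = false by rewrite -val_eqE /= gtn_eqF.
split; last 1 first.
- exists (bivector (iso (i, true)) (iso (j, s))); last exact: root_vector_iso.
  (* The form pairs this root vector with the opposite one to 4, so it is nonzero. *)
  move=> /(congr1 (fun x => so_form x (bivector (iso (j, ~~ s)) (iso (i, false))))).
  rewrite so_form_bivector !dot_iso // /dual -!pair_eqE /= !eqxx ji /= negbK eqxx.
  rewrite [i == j]eq_sym ji /= mulr0 subr0.
  rewrite so_form0l => /eqP.
  by rewrite mulf_eq0 pnatr_eq0.
- move=> /rowP/(_ i); rewrite !mxE /wt /= eqxx ji addr0 => /eqP.
  by rewrite oner_eq0.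
have -> : so_root i j s = if s then ek i + ek j else ek i - ek j.
  apply/rowP=> k; rewrite mxE /wt /= [i == k]eq_sym [j == k]eq_sym.
  by case: s; rewrite !mxE -!val_eqE; case: eqP; case: eqP => //=; rewrite ?oppr0.
by case: s; [apply: nat_span_add | apply: nat_span_sub] => //; exact: ltnW.
Qed.

End RootSystem.

(** * The weight family in coordinates *)

Section WeightFamily.
Variables (K : numClosedFieldType) (n N : nat) (nE : n.+1 = N.*2) (N_gt1 : (1 < N)%N).
Local Notation weight_form := (@weight_form K n N).
Local Notation coroot := (@simple_coroot K n N).
Implicit Types (i j : 'I_N) (y z : 'rV[K]_N) (x : K) (k t : nat).

(** Indexed by [nat] and equal to 0 from [N] on, so that neighbouring indices can be named without
    bounds. *)
Definition coord y k : K := \sum_j y 0 j * (j == k :> nat)%:R.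

Lemma coordE y j : coord y j = y 0 j.
Proof.
rewrite /coord (bigD1 j) //= eqxx mulr1 big1 ?addr0 // => i ij.
by rewrite -val_eqE in ij; rewrite (negbTE ij) mulr0.
Qed.

Lemma coord_row (f : nat -> K) k : (k < N)%N -> coord (\row_j f j) k = f k.
Proof. by move=> kN; rewrite (coordE _ (Ordinal kN)) mxE. Qed.

Lemma weight_form_simple_root y i : weight_form y (simple_root K i) =
  if (i.+1 < N)%N then coord y i - coord y i.+1 else coord y i.-1 + coord y i.
Proof.
rewrite (weight_formE nE) /simple_root /coord; case: ifP => _.
  by rewrite -sumrB; apply: eq_bigr => j _; rewrite mxE -val_eqE mulrBr.
by rewrite -big_split; apply: eq_bigr => j _; rewrite mxE -val_eqE mulrDr.
Qed.

(** Every simple root has squared length 2; in the last case this uses that its two indices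
    differ. *)
Lemma simple_corootE i : coroot i = simple_root K i.
Proof.
rewrite /simple_coroot weight_form_simple_root.
suff -> : (if (i.+1 < N)%N then coord (simple_root K i) i - coord (simple_root K i) i.+1
           else coord (simple_root K i) i.-1 + coord (simple_root K i) i) = 2.
  by rewrite divff ?scale1r // pnatr_eq0.
rewrite /simple_root; case: ifP => iN; rewrite ?iN.
  pose f k : K := (k == i)%:R - (k == i.+1)%:R.
  rewrite (_ : \row_j _ = \row_j f j); last by apply/rowP => j; rewrite !mxE.
  rewrite !(coord_row f) // /f !eqxx.
  have -> : (nat_of_ord i == i.+1) = false by lia.
  have -> : (i.+1 == nat_of_ord i) = false by lia.
  by rewrite /=; ring.
pose f k : K := (k == i.-1)%:R + (k == i)%:R.
rewrite (_ : \row_j _ = \row_j f j); last by apply/rowP => j; rewrite !mxE.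
rewrite !(coord_row f) //; last by rewrite (leq_ltn_trans (leq_pred i)).
have i_gt0 : (0 < i)%N by move: iN; case: (i : nat) => //=; rewrite N_gt1.
rewrite /f !eqxx; have -> : (i.-1 == nat_of_ord i) = false by lia.
have -> : (nat_of_ord i == i.-1) = false by lia.
by rewrite /=; ring.
Qed.

Lemma weight_form_coroot y i : weight_form y (coroot i) =
  if (i.+1 < N)%N then coord y i - coord y i.+1 else coord y i.-1 + coord y i.
Proof. by rewrite simple_corootE weight_form_simple_root. Qed.

Lemma weight_form_linear_l x y z h :
  weight_form (x *: y + z) h = x * weight_form y h + weight_form z h.
Proof.
rewrite !(weight_formE nE) mulr_sumr -big_split; apply: eq_bigr => j _ /=.
by rewrite !mxE; ring.
Qed.

(** The coroots eps_k - eps_{k+1} make the coordinate differences [d] constant, and the last coroot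
    gives 2 d = 0. *)
Lemma coroot_separated y z :
  (forall i, weight_form y (coroot i) = weight_form z (coroot i)) -> y = z.
Proof.
move=> yz; pose d k := coord y k - coord z k.
have dS k : (k.+1 < N)%N -> d k.+1 = d k.
  move=> kN; have := yz (Ordinal (ltnW kN)); rewrite !weight_form_coroot /= kN /d.
  by move=> H; apply/eqP; rewrite -subr_eq0; apply/eqP; move: H => /eqP;
     rewrite -subr_eq0 => /eqP H; rewrite -[RHS]oppr0 -H; ring.
have dE k : (k < N)%N -> d k = d 0%N.
  by elim: k => // k IH kN; rewrite dS // IH // ltnW.
have N1 : (N.-1 < N)%N by rewrite prednK // ltnW.
have d0 : d 0%N = 0.
  have := yz (Ordinal N1); rewrite !weight_form_coroot /= (_ : (N.-1.+1 < N)%N = false); last lia.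
  move=> H; apply: (@self_opp_eq0 K K^o).
  have dA : d N.-2 = d 0%N by apply: dE; lia.
  rewrite -[LHS]dA -(dE _ N1) /d; apply/eqP; rewrite -subr_eq0; apply/eqP.
  by move: H => /eqP; rewrite -subr_eq0 => /eqP <-; ring.
apply/rowP => j; have := dE j (ltn_ord j); rewrite d0 /d !coordE => /eqP.
by rewrite subr_eq0 => /eqP.
Qed.

Definition staircase t x k : K :=
  if (k.+1 < t)%N then -1 else if k.+1 == t then x else 0.

(** Fundamental weights are given by their pairings with the simple coroots, so the two sides are
    compared through these pairings. *)
Lemma weight_familyE (pi : nat -> 'rV[K]_N) t x : fundamental_weights n pi ->
  (1 <= t <= N)%N -> weight_family pi t x = \row_j staircase t x j.
Proof.
move=> [pi0 piP] /andP[t1 tN]; apply: coroot_separated => i.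
have f0 h : weight_form 0 h = 0.
  by rewrite (weight_formE nE) big1 // => j _; rewrite mxE mul0r.
have piE k : (k <= N)%N -> weight_form (pi k) (coroot i) = (k == i.+1)%:R.
  by case: k => [|k] kN; [rewrite pi0 f0 | rewrite (piP (Ordinal kN))].
have formZ a y h : weight_form (a *: y) h = a * weight_form y h.
  by rewrite -[a *: y]addr0 weight_form_linear_l f0 addr0.
have formD y z h : weight_form (y + z) h = weight_form y h + weight_form z h.
  by rewrite -[y]scale1r weight_form_linear_l scale1r mul1r.
have iN := ltn_ord i.
have -> : weight_form (weight_family pi t x) (coroot i) =
    if t == N then (-1 - x) * (N.-1 == i.+1)%:R + (-1 + x) * (N == i.+1)%:R
    else if t == N.-1 then
      (-1 - x) * (N.-2 == i.+1)%:R + x * (N.-1 == i.+1)%:R + x * (N == i.+1)%:R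
    else if t == 1%N then x * (1 == i.+1)%N%:R
    else (-1 - x) * (t.-1 == i.+1)%:R + x * (t == i.+1)%:R.
  by rewrite /weight_family; do ?case: ifP => _; rewrite !(formD, formZ) ?piE //; lia.
rewrite [RHS]weight_form_coroot; case: ltnP => hi.
  rewrite !(coord_row (staircase t x)) // /staircase.
  by do !(first [case: eqP => ? | case: ltnP => ?]; try (exfalso; lia)); rewrite /=; ring.
rewrite !(coord_row (staircase t x)); [|lia|lia]; rewrite /staircase.
by do !(first [case: eqP => ? | case: ltnP => ?]; try (exfalso; lia)); rewrite /=; ring.
Qed.

End WeightFamily.

(* The zero weight is the case t = 1, x = 0. *)
Lemma staircaseP (K : numClosedFieldType) (N : nat) (y : 'rV[K]_N) : (0 < N)%N ->
  (forall i j : 'I_N, (i < j)%N -> y 0 j * (y 0 i + 1) = 0) <->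
  exists t x, (1 <= t <= N)%N /\ y = \row_j staircase t x j.
Proof.
move=> N_gt0; split=> [yP|[t [x [_ ->]]] i j ij]; last first.
  rewrite !mxE /staircase.
  by do !(first [case: eqP => ? | case: ltnP => ?]; try (exfalso; lia)); rewrite /=; ring.
have [[j yj]|y0] := pselect (exists j, y 0 j != 0).
  (* The last nonzero coordinate: it is [x], and each earlier coordinate must be -1. *)
  have [k yk kmax] := @arg_maxnP _ j (fun l => y 0 l != 0) val yj.
  exists k.+1, (y 0 k); split; [by rewrite /= ltn_ord|]; apply/rowP => l; rewrite mxE /staircase.
  rewrite ltnS eqSS; case: ltngtP => [lk|kl|/val_inj-> //].
    have /eqP := yP _ _ lk; rewrite mulf_eq0 (negbTE yk) /= addr_eq0.
    by move/eqP.
  apply/eqP; case: (y 0 l =P 0) => // /eqP /kmax /=; lia.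
exists 1%N, 0; split; first lia.
apply/rowP => l; rewrite mxE /staircase /=.
have -> : y 0 l = 0 by apply/eqP/negPn/negP => yl; apply: y0; exists l.
by case: ifP.
Qed.

(** * The highest weight vector of the irreducible quotient *)

Section Generation.
Variables (K : fieldType) (L : lmodType K) (br : L -> L -> L).

(** Words span the free algebra, and each arises from the empty word by left multiplication by
    letters; the statement descends to the quotient. *)
Lemma UEA_ind (P : UEA br -> Prop) :
  P 0 -> P 1 -> (forall k u w, P u -> P w -> P (k *: u + w)) ->
  (forall x u, P u -> P (UEA_inj br x * u)) -> forall u, P u.
Proof.
move=> P0 P1 Plin Pmul u.
pose piU (t : free_alg K L) : UEA br := alg_quot_pi (UEA_relation br) t.
have piD : {morph piU : s t / s + t} by move=> s t; exact: alg_quot_piD.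
have pi0 : piU 0 = 0 by apply: (@addIr _ (piU 0)); rewrite -piD !add0r.
suff Pt (t : free_alg K L) : P (piU t).
  rewrite -[u](alg_quot_piK (u : alg_quot (UEA_relation br))); exact: Pt.
rewrite [t](monalgE (t : {malg K[{fmonom L}]})).
apply: (big_ind (fun t => P (piU t))) => [|s w Ps Pw|m _].
- by rewrite pi0.
- by rewrite piD -[piU s]scale1r; exact: Plin.
have -> : << (t : {malg K[{fmonom L}]})@_m *g m >> =
    (t : {malg K[{fmonom L}]})@_m *: (<< m >> : free_alg K L).
  by apply/malgP => m'; rewrite mcoeffZ !mcoeffU mulr_natr.
rewrite [piU _]alg_quot_piZ -[_ *: _]addr0; apply: Plin => //.
case: m => s; elim: s => [|x s IH].
  rewrite -(fmoneE L); exact: P1.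
rewrite (_ : << _ >> = letter x * << FMonom s >> :> free_alg K L).
  by rewrite [alg_quot_pi _ _]alg_quot_piM; exact: Pmul.
rewrite [RHS]fgmulUU mulr1; congr << _ >>.
by rewrite [RHS]fmmulE fmuE.
Qed.

End Generation.

Section HighestWeightQuotient.
Variables (K : numClosedFieldType) (n N : nat) (nE : n.+1 = N.*2).
Variables (lam : 'rV[K]_N) (Z : lmodType K) (rho : so K n.+1 -> Z -> Z).

(** The vector is the image of the class of 1. The Verma relations make it singular of weight [lam];
    as 1 generates the Verma module and [f] is onto, it is nonzero. *)
Lemma highest_weight_vector : irreducible_quotient_of_verma lam rho ->
  exists v, [/\ v <> 0, singular N rho v & weight_vector rho (lam 0) v].
Proof.
move=> [rhoP [[z0 z0_neq0] _] [f [f_surj f_act]]].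
pose g (a : UEA (@so_bracket K n.+1)) : Z :=
  f (left_quot_pi (verma_relation lam) a : verma n lam).
have gM x a : g (U_so_inj x * a) = rho x (g a).
  by rewrite -f_act /verma_act left_quot_actE.
have glin k a b : g (k *: a + b) = k *: g a + g b by rewrite /g !linearP.
have g0 : g 0 = 0 by rewrite /g !linear0.
have gU x : g (U_so_inj x) = rho x (g 1) by rewrite -gM mulr1.
have g_rel a : verma_relation lam a -> g a = 0.
  move=> la; rewrite /g (_ : left_quot_pi _ a = 0) ?linear0 //.
  rewrite -[RHS](linear0 (left_quot_pi (verma_relation lam))).
  apply/lquot_piP; rewrite subr0; apply/asboolP; exact: LeftGen.
exists (g 1); split.
- move=> g1; apply: z0_neq0; have [w <-] := f_surj z0.
  rewrite -[w](lquot_piK (w : lquot (left_ideal_submod (verma_relation lam)))).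
  rewrite -[LHS]/(g _).
  apply: (UEA_ind (P := fun a => g a = 0)) => [|//|k a b ga gb|x a ga].
  + exact: g0.
  + by rewrite glin ga gb scaler0 addr0.
  + by rewrite [UEA_inj _ _]/(U_so_inj x) gM ga (rho0r rhoP).
- move=> i j s ij; rewrite -[LHS]gU; apply: g_rel.
  apply: (verma_positive _ (alpha := so_root K i j s)); first exact: positive_root_iso.
  exact: root_vector_iso.
- move=> j; have := g_rel _ (verma_cartan n lam (delta_mx 0 j)).
  rewrite cartan_delta => /eqP; rewrite -scaleNr addrC glin gU.
  rewrite scaleNr addrC subr_eq0 => /eqP ->; congr (_ *: _).
  rewrite (weight_formE nE) (bigD1 j) //= mxE !eqxx mulr1 big1 ?addr0 // => i ij.
  by rewrite mxE (negbTE ij) andbF mulr0.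
Qed.

End HighestWeightQuotient.

(** * Classification of the highest weights *)

Theorem theorem1p2 (R : realType) (n N : nat) (n_ge3 : (3 <= n)%N)
  (nE : n.+1 = N.*2)
  (pi : nat -> 'rV[R[i]]_N) (piP : fundamental_weights n pi)
  (lam : 'rV[R[i]]_N)
  (Z : lmodType R[i]) (rho : so R[i] n.+1 -> Z -> Z)
  (ZP : irreducible_quotient_of_verma lam rho) :
  irreducible_representation rho <->
  exists (t : nat) (x : R[i]), (1 <= t <= N)%N /\ lam = weight_family pi t x.
Proof.
have N_gt1 : (1 < N)%N by lia.
have [rhoP Zirr _] := ZP; have [v [v_neq0 v_sing v_wt]] := highest_weight_vector nE ZP.
have [repP1 repP2] := irreducible_representationP rhoP n_ge3 Zirr.
have [lamP1 lamP2]  := staircaseP lam (ltnW N_gt1).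
split=> [/repP1 pf0|[t [x [tN lamE]]]].
  have [i j ij|t [x [tN lamE]]] := lamP1.
    have /eqP := pfaffian_hw nE rhoP v_sing v_wt ij.
    rewrite pf0 eq_sym scaler_eq0 mulf_eq0 pnatr_eq0 /= => /orP[/eqP //|/eqP].
    by move/v_neq0.
  by exists t, x; rewrite (weight_familyE nE N_gt1 x piP tN).
apply: repP2; apply: (pfaffian_eq0 nE rhoP v_sing v_wt) => //.
by apply: lamP2; exists t, x; rewrite -(weight_familyE nE N_gt1 x piP tN).
Qed.
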